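(* Let $A$ be a finite alphabet, let $F\subset A^*$ be a uniformly recurrent set, let $Z\subset A^+$ be a group code of degree $d$ and let $X=Z\cap F$. Let $h:A^*\to G$ be the canonical morphism from $A^*$ onto the syntactic monoid $G$ of $Z^*$ (which is a finite group), and let $\hat h:\widehat{A^*}\to G$ be its continuous extension to the free profinite monoid. Let $H$ be a maximal subgroup contained in $J(F)$. Then the restriction of $\hat h$ to $H$ is surjective onto $G$ if and only if the following three properties hold. (i) $X$ is an $F$-maximal bifix code of $F$-degree $d$. (ii) $G_X(F)$ is isomorphic to $G$. (iii) The morphism $\hat\varphi_X$ maps each $\mathcal H$-class of $J(F)$ which is a group onto $G_X(F)$, that is, onto a maximal subgroup of the $\mathcal J$-class $J_X(F)$.
   Context: Words and sets. $A$ is a finite alphabet. A set $F\subset A^*$ is factorial if it contains $A$ and all factors of its elements. It is recurrent if it is factorial and for all $x,z\in F$ there is $y\in F$ with $xyz\in F$. An infinite factorial set $F$ is uniformly recurrent if for every $x\in F$ there is $n\ge 1$ such that $x$ is a factor of every word of $F$ of length $n$ (such a set is recurrent). Free profinite monoid. $\widehat{A^*}$ is the free profinite monoid on $A$, i.e. the projective limit of all $A$-generated finite monoids; $A^*$ embeds in it as a dense submonoid, and every morphism from $A^*$ to a finite monoid (discrete topology) extends uniquely to a continuous morphism on $\widehat{A^*}$, the extension of $\varphi$ being denoted $\hat\varphi$. Elements of $\widehat{A^*}$ are pseudowords; those of $\widehat{A^*}\setminus A^*$ are infinite pseudowords. $\mathcal J,\mathcal H$ denote Green's relations (two elements are $\mathcal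 J$-equivalent if each is a factor of the other). For a uniformly recurrent set $F$ with closure $\bar F$ in $\widehat{A^*}$, all infinite pseudowords in $\bar F$ are $\mathcal J$-equivalent in $\widehat{A^*}$; $J(F)$ denotes their $\mathcal J$-class. The maximal subgroups contained in $J(F)$ are the $\mathcal H$-classes of $J(F)$ that are groups. Codes. A set $X\subset A^+$ is a bifix code if no element of $X$ is a proper prefix or a proper suffix of another element of $X$. A group code of degree $d$ is a bifix code $Z$ such that $Z^*=g^{-1}(K)$ for some morphism $g$ from $A^*$ onto a group and some subgroup $K$ of index $d$ of that group ($Z$ is then the minimal generating set of $Z^*$). A bifix code $X\subset F$ is $F$-maximal if it is not properly contained in any bifix code $Y\subset F$. A parse of $w\in A^*$ with respect to $X$ is a triple $(p,x,q)$ with $w=pxq$ such that $p$ has no suffix in $X$, $x\in X^*$ and $q$ has no prefix in $X$. The $F$-degree $d_X(F)$ of a bifix code $X$ is the maximal number of parses (with respect to $X$) of a word of $F$. Groups. Let $\mathcal A$ be the minimal (trim, deterministic) automaton of $X^*$, with state set $Q$. For $w\in A^*$ let $\varphi_X(w)$ be the partial map $Q\to Q$ defined by the action of $w$ on the states, so that $\varphi_X$ is a morphism from $A^*$ onto the transition monoid $\varphi_X(A^* )$ of $\mathcal A$. The rank of a partial map is the cardinality of its image. Let $r$ be the minimum of the ranks of $\varphi_X(w)$ for $w\in F$. The elements of $\varphi_X(F)$ of rank $r$ are all contained in a single regular $\mathcal J$-class of $\varphi_X(A^* )$, denoted $J_X(F)$. The group $G_X(F)$ is the structure group of $J_X(F)$,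 i.e. the group to which all maximal subgroups contained in $J_X(F)$ are isomorphic. *)

(* Defs.v *)
From HB Require Import structures.
From mathcomp Require Import all_boot.
From mathcomp Require Import generic_quotient.
From mathcomp Require Import all_classical topology.

Set Implicit Arguments.
Unset Strict Implicit.
Unset Printing Implicit Defensive.

Local Open Scope classical_set_scope.
Local Open Scope card_scope.
Local Open Scope group_scope.

HB.instance Definition _ (A : choiceType) :=
  isMonoid.Build (seq A) (@catA A) (@cat0s A) (@cats0 A).

Section Words.
Context {A : finType}.
Implicit Types (F X Z L : set (seq A)) (u v w x y z : seq A).

Definition factorial_set F : Prop :=
  (forall a : A, F [:: a]) /\ (forall u v, F v -> infix u v -> F u).

Definition uniformly_recurrent F : Prop :=
  [/\ factorial_set F, infinite_set F &
      forall x, F x -> exists2 n, (1 <= n)%N &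
        forall w, F w -> size w = n -> infix x w].

Definition star X : set (seq A) :=
  [set w | exists2 s : seq (seq A), (forall x, x \in s -> X x) & w = flatten s].

Definition bifix_code X : Prop :=
  [/\ ~ X [::],
      forall x y, X x -> X y -> prefix x y -> x = y &
      forall x y, X x -> X y -> suffix x y -> x = y].

(* The index of [K] is the cardinality of the set of right cosets [K x]. *)
Definition group_code Z (d : nat) : Prop :=
  bifix_code Z /\
  exists (G : groupType) (g : seq A -> G) (K : {pred G}),
    [/\ monoid_morphism g, set_surj setT setT g, group_closed K,
        range (fun x : G => [set z | z / x \in K]) #= `I_d &
        star Z = [set w | g w \in K]].

Definition maximal_bifix_code F X : Prop :=
  [/\ bifix_code X, X `<=` F &
      forall Y, bifix_code Y -> Y `<=` F -> X `<=` Y -> X = Y].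

Definition parses X w : set (seq A * seq A * seq A) :=
  [set t | let: (p, x, q) := t in
     [/\ w = p ++ x ++ q, forall y, X y -> ~~ suffix y p, star X x &
         forall y, X y -> ~~ prefix y q]].

Definition has_degree F X (d : nat) : Prop :=
  (exists2 w, F w & parses X w #= `I_d) /\
  (forall w, F w -> parses X w #<= `I_d).

End Words.

Section Green.
Context {M : monoidType}.
Implicit Types (x y : M) (H J : set M).

Definition factor x y : Prop := exists a b, y = a * x * b.
Definition Jrel x y : Prop := factor x y /\ factor y x.
Definition Rrel x y : Prop := (exists a, y = x * a) /\ (exists b, x = y * b).
Definition Lrel x y : Prop := (exists a, y = a * x) /\ (exists b, x = b * y).
Definition Hrel x y : Prop := Rrel x y /\ Lrel x y.

(* [H] is a group for the product of [M]; its identity need not be [1]. *)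
Definition is_group H : Prop :=
  (forall x y, H x -> H y -> H (x * y)) /\
  exists2 e, H e & forall x, H x ->
    [/\ e * x = x, x * e = x & exists2 y, H y & x * y = e /\ y * x = e].

Definition maximal_subgroup_in J H : Prop :=
  (exists2 x, J x & H = [set y | Hrel x y]) /\ is_group H.

Definition isomorphic H (G : monoidType) : Prop :=
  exists2 f : M -> G, set_bij H setT f &
    forall x y, H x -> H y -> f (x * y) = f x * f y.

Definition structure_group_isomorphic J (G : monoidType) : Prop :=
  (exists H, maximal_subgroup_in J H) /\
  (forall H, maximal_subgroup_in J H -> isomorphic H G).

End Green.

(* An [A]-generated finite monoid. Up to isomorphism its carrier is an
   ordinal, which makes these monoids form a small type. *)
Record gen_monoid (A : finType) := GenMonoid {
  gm_card : nat;
  gm_mul : 'I_gm_card -> 'I_gm_card -> 'I_gm_card;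
  gm_one : 'I_gm_card;
  gm_gen : A -> 'I_gm_card;
  gm_mulA : associative gm_mul;
  gm_mul1 : left_id gm_one gm_mul;
  gm_mulr1 : right_id gm_one gm_mul;
  gm_generated : forall x, exists s : seq A,
    foldr (fun a => gm_mul (gm_gen a)) gm_one s = x }.

HB.instance Definition _ (A : finType) := gen_eqMixin (gen_monoid A).
HB.instance Definition _ (A : finType) := gen_choiceMixin (gen_monoid A).

Definition gm_carrier (A : finType) (M : gen_monoid A) : Type :=
  discrete_topology 'I_(gm_card M).
HB.instance Definition _ (A : finType) (M : gen_monoid A) :=
  DiscreteTopology.on (gm_carrier M).

Section Profinite.
Context (A : finType).

Definition gm_morphism (M N : gen_monoid A)
    (f : 'I_(gm_card M) -> 'I_(gm_card N)) : Prop :=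
  [/\ f (gm_one M) = gm_one N,
      forall x y, f (gm_mul x y) = gm_mul (f x) (f y) &
      forall a, f (gm_gen M a) = gm_gen N a].

Definition compatible : set (prod_topology (@gm_carrier A)) :=
  [set u | forall M N (f : 'I_(gm_card M) -> 'I_(gm_card N)),
     gm_morphism f -> f (u M) = u N].

Definition pword : Type := compatible.
HB.instance Definition _ := Topological.on pword.

Fact pword_mul_subproof (u v : pword) :
  (fun M => gm_mul (val u M) (val v M)) \in compatible.
Proof.
apply/mem_set => M N f fmor; case: (fmor) => _ fM _.
by rewrite fM (set_mem (valP u) _ _ _ fmor) (set_mem (valP v) _ _ _ fmor).
Qed.

Fact pword_of_subproof (w : seq A) :
  (fun M => foldr (fun a => gm_mul (gm_gen M a)) (gm_one M) w) \in compatible.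
Proof.
apply/mem_set => M N f [f1 fM fg].
by elim: w => [|a w IH] //=; rewrite fM fg IH.
Qed.

Definition pword_of (w : seq A) : pword :=
  exist (fun u => u \in compatible) _ (pword_of_subproof w).
Definition pword_mul (u v : pword) : pword :=
  exist (fun u => u \in compatible) _ (pword_mul_subproof u v).

Fact pword_mulA : associative pword_mul.
Proof.
by move=> u v w; apply/val_inj/functional_extensionality_dep => M; exact: gm_mulA.
Qed.
Fact pword_mul1 : left_id (pword_of [::]) pword_mul.
Proof.
by move=> u; apply/val_inj/functional_extensionality_dep => M; exact: gm_mul1.
Qed.
Fact pword_mulr1 : right_id (pword_of [::]) pword_mul.
Proof.
by move=> u; apply/val_inj/functional_extensionality_dep => M; exact: gm_mulr1.
Qed.
HB.instance Definition _ :=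
  isMonoid.Build pword pword_mulA pword_mul1 pword_mulr1.

Definition infinite_pword : set pword := ~` range pword_of.

Definition JF (F : set (seq A)) : set pword :=
  [set u | exists v, [/\ closure (pword_of @` F) v, infinite_pword v & Jrel u v]].

Definition continuous_extension (M : monoidType) (phi : seq A -> M)
    (psi : pword -> M) : Prop :=
  [/\ monoid_morphism psi, continuous (psi : pword -> discrete_topology M) &
      forall w, psi (pword_of w) = phi w].

(* The continuous extension of [phi], which exists when [range phi] is finite
   (see [hatP] below); a dummy value if there is none. *)
Definition hat (M : monoidType) (phi : seq A -> M) : pword -> M :=
  xget (fun=> 1) (continuous_extension phi).

End Profinite.

Arguments JF {A} F.

Section ExtensionExists.
Context (A : finType) (M : monoidType) (phi : seq A -> M).
Context (phim : monoid_morphism phi) (s : seq M).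
Context (sE : forall x, reflect (exists w, phi w = x) (x \in s)) (su : uniq s).
Let n := size s.
Let e (i : 'I_n) : M := nth 1 s i.
Let es i : e i \in s. Proof. by rewrite /e mem_nth. Qed.
Let r x (h : x \in s) : 'I_n := Ordinal (eq_ind_r is_true h (index_mem x s)).
Let rK x h : e (@r x h) = x. Proof. by rewrite /e nth_index. Qed.
Let ei : injective e.
Proof. by move=> i j /eqP; rewrite nth_uniq // => /eqP/val_inj. Qed.
Let phis w : phi w \in s. Proof. by apply/sE; exists w. Qed.
Let ms i j : e i * e j \in s.
Proof.
case/sE: (es i) => u <-; case/sE: (es j) => v <-; apply/sE; exists (u ++ v).
by rewrite -phim.2.
Qed.
Let mul i j := @r _ (ms i j).
Let one := @r _ (phis [::]).
Let gen a := @r _ (phis [:: a]).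
Let eone : e one = 1. Proof. by rewrite /one rK phim.1. Qed.
Let mulA : associative mul.
Proof. by move=> x y z; apply: ei; rewrite !rK mulgA. Qed.
Let mul1 : left_id one mul.
Proof. by move=> x; apply: ei; rewrite rK eone mul1g. Qed.
Let mulr1 : right_id one mul.
Proof. by move=> x; apply: ei; rewrite rK eone mulg1. Qed.
Let fE w : e (foldr (fun a => mul (gen a)) one w) = phi w.
Proof.
elim: w => [|a w IH] /=; first by rewrite rK.
by rewrite rK IH rK -phim.2.
Qed.
Let gend x : exists w, foldr (fun a => mul (gen a)) one w = x.
Proof. by case/sE: (es x) => w h; exists w; apply: ei; rewrite fE. Qed.
Let N := GenMonoid mulA mul1 mulr1 gend.
Lemma continuous_extension_exists :
  continuous_extension phi (fun u : pword A => e (val u N)).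
Proof.
split; first split.
- exact: eone.
- by move=> u v; exact: rK.
- move=> u U Ux0.
  have Ux : U (e (val u N)) by move: Ux0; exact: nbhs_singleton.
  have : continuous (fun u : pword A => val u N : gm_carrier N).
    move=> v.
    apply: (@continuous_comp (pword A) (prod_topology (@gm_carrier A))
      (gm_carrier N) val (fun f => f N) v).
      exact: (@initial_continuous (pword A) (prod_topology (@gm_carrier A)) val).
    exact: (@proj_continuous _ (fun M => (gm_carrier M : topologicalType)) N).
  move=> /(_ u [set val u N]) h.
  have : nbhs (val u N : gm_carrier N) [set val u N] by exact: discrete_set1.
  move=> /h H1.
  apply: (@filterS _ (nbhs u) _ _ _ _ H1) => v /= vE. by rewrite /= vE.
- exact: fE.
Qed.
End ExtensionExists.

Lemma hatP (A : finType) (M : monoidType) (phi : seq A -> M) :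
  finite_set (range phi) -> monoid_morphism phi ->
  continuous_extension phi (hat phi).
Proof.
move=> fM pm. apply: xgetPex.
have [t tE] := (finite_seqP _).1 fM.
have sE x : reflect (exists w, phi w = x) (x \in undup t).
  rewrite mem_undup; apply: (iffP idP) => [xt|[w <-]].
    have : [set` t] x by []. rewrite -tE => -[w _ <-]; by exists w.
  have : range phi (phi w) by exists w. by rewrite tE.
eexists; apply: (@continuous_extension_exists A M phi pm _ sE); exact: undup_uniq.
Qed.

Section Syntactic.
Context {A : finType} (L : set (seq A)).

Definition synt_rel : rel (seq A) :=
  fun u v => `[< forall x y, L (x ++ u ++ y) <-> L (x ++ v ++ y) >].

Fact synt_refl : reflexive synt_rel.
Proof. by move=> u; apply/asboolP. Qed.
Fact synt_sym : symmetric synt_rel.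
Proof.
by move=> u v; apply/asboolP/asboolP => h x y; split=> /h.
Qed.
Fact synt_trans : transitive synt_rel.
Proof.
move=> v u w /asboolP h /asboolP k; apply/asboolP => x y.
exact: iff_trans (h x y) (k x y).
Qed.
Canonical synt_equiv := EquivRel synt_rel synt_refl synt_sym synt_trans.

Definition synt_monoid : Type := {eq_quot synt_equiv}%qT.
HB.instance Definition _ := Choice.on synt_monoid.
HB.instance Definition _ := EqQuotient.on synt_monoid.

Definition synt_proj (w : seq A) : synt_monoid := (\pi w)%qT.
Definition synt_mul (x y : synt_monoid) : synt_monoid :=
  synt_proj (repr x ++ repr y).

Lemma synt_projM u v : synt_proj (u ++ v) = synt_mul (synt_proj u) (synt_proj v).
Proof.
have reprP w : synt_rel (repr (synt_proj w)) w.
  by apply/(@eqquotP _ _ synt_monoid); rewrite reprK.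
apply/(@eqquotP _ _ synt_monoid)/asboolP => x y.
move: (reprP u) (reprP v) => /asboolP hu /asboolP hv.
rewrite -!catA; split => [/hu|/hu].
  by rewrite (catA x) => /hv; rewrite -catA.
by rewrite (catA x) => /hv; rewrite -catA.
Qed.

Fact synt_mulA : associative synt_mul.
Proof.
move=> x y z; rewrite -[x]reprK -[y]reprK -[z]reprK.
by rewrite -/(synt_proj _) -/(synt_proj (repr y)) -/(synt_proj (repr z))
  -!synt_projM catA.
Qed.
Fact synt_mul1 : left_id (synt_proj [::]) synt_mul.
Proof.
by move=> x; rewrite -[x]reprK -/(synt_proj _) -synt_projM.
Qed.
Fact synt_mulr1 : right_id (synt_proj [::]) synt_mul.
Proof.
by move=> x; rewrite -[x]reprK -/(synt_proj _) -synt_projM cats0.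
Qed.
HB.instance Definition _ :=
  isMonoid.Build synt_monoid synt_mulA synt_mul1 synt_mulr1.

End Syntactic.

Definition partial_map (Q : Type) : Type := Q -> option Q.
HB.instance Definition _ (Q : choiceType) := Choice.on (partial_map Q).

(* Words act on the right, so a product is applied from left to right. *)
Definition pmap_mul (Q : Type) (f g : partial_map Q) : partial_map Q :=
  fun q => obind g (f q).
Definition pmap_one (Q : Type) : partial_map Q := fun q => Some q.
Fact pmap_mulA (Q : Type) : associative (@pmap_mul Q).
Proof. by move=> f g h; apply/funext => q; rewrite /pmap_mul; case: (f q). Qed.
Fact pmap_mul1 (Q : Type) : left_id (@pmap_one Q) (@pmap_mul Q).
Proof. by []. Qed.
Fact pmap_mulr1 (Q : Type) : right_id (@pmap_one Q) (@pmap_mul Q).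
Proof. by move=> f; apply/funext => q; rewrite /pmap_mul; case: (f q). Qed.
HB.instance Definition _ (Q : choiceType) :=
  isMonoid.Build (partial_map Q) (@pmap_mulA Q) (@pmap_mul1 Q) (@pmap_mulr1 Q).

Definition pmap_image (Q : Type) (f : partial_map Q) : set Q :=
  [set q | exists p, f p = Some q].

Section MinimalAutomaton.
Context {A : finType} (L : set (seq A)).

Definition residual (S : set (seq A)) (u : seq A) : set (seq A) :=
  [set v | S (u ++ v)].

(* The states of the trim minimal automaton of [L]: its nonempty residuals. *)
Definition states : set (set (seq A)) :=
  [set S | S !=set0 /\ exists u, S = residual L u].

(* [insub S] is [Some] of the state [S] if [S] is a state, [None] otherwise. *)
Definition act (w : seq A) : partial_map states :=
  fun q => insub (residual (val q) w).

Lemma act_nil : act [::] = 1.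
Proof. by apply/funext => q; rewrite /act (valK q : insub _ = _). Qed.

Lemma act_cat u v : act (u ++ v) = act u * act v.
Proof.
apply/funext => q; rewrite /act /mul /= /pmap_mul.
have resM S : residual S (u ++ v) = residual (residual S u) v.
  by apply/seteqP; split=> x /=; rewrite /residual /= catA.
rewrite resM; case: (insubP states (residual (val q) u)) => [p _ <- //|nst].
rewrite insubF //; apply/negbTE/negP => /set_mem [[x rx] _].
move/negP: nst; apply; apply/mem_set; split; first by exists (v ++ x).
case: (set_mem (valP q)) => _ [w qE]; exists (w ++ u).
by rewrite qE; apply/seteqP; split=> y /=; rewrite /residual /= catA.
Qed.

Definition transition_monoid : Type := range act.
HB.instance Definition _ := Choice.on transition_monoid.

Definition trans (w : seq A) : transition_monoid :=
  exist (fun f => f \in range act) (act w) (mem_set (ex_intro2 _ _ w I erefl)).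

Fact trans_mul_subproof (x y : transition_monoid) : val x * val y \in range act.
Proof.
apply/mem_set; case: (set_mem (valP x)) => u _ <-.
by case: (set_mem (valP y)) => v _ <-; exists (u ++ v) => //; rewrite act_cat.
Qed.
Definition trans_mul (x y : transition_monoid) : transition_monoid :=
  exist (fun f => f \in range act) _ (trans_mul_subproof x y).
Fact trans_mulA : associative trans_mul.
Proof. by move=> x y z; apply/val_inj; rewrite /= mulgA. Qed.
Fact trans_mul1 : left_id (trans [::]) trans_mul.
Proof. by move=> x; apply/val_inj; rewrite /= act_nil mul1g. Qed.
Fact trans_mulr1 : right_id (trans [::]) trans_mul.
Proof. by move=> x; apply/val_inj; rewrite /= act_nil mulg1. Qed.
HB.instance Definition _ :=
  isMonoid.Build transition_monoid trans_mulA trans_mul1 trans_mulr1.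

End MinimalAutomaton.

Section CodeGroup.
Context {A : finType} (F X : set (seq A)).

Definition phiX : seq A -> transition_monoid (star X) := @trans A (star X).

Definition rank_le (m m' : transition_monoid (star X)) : Prop :=
  pmap_image (val m) #<= pmap_image (val m').

Definition minimal_rank (m : transition_monoid (star X)) : Prop :=
  (phiX @` F) m /\ forall w, F w -> rank_le m (phiX w).

(* The J-class containing the elements of [phiX @` F] of minimal rank. *)
Definition JX : set (transition_monoid (star X)) :=
  [set m | exists2 m', minimal_rank m' & Jrel m m'].

End CodeGroup.

Arguments JX {A} F X.

(* Main.v *)
From HB Require Import structures.
Require Import Defs.
From mathcomp Require Import all_boot finmap.
From mathcomp Require Import all_classical topology.

(* Since [X = Z ∩ F], the minimal automaton of [X^*] maps, compatibly with words,
   to the group automaton of [Z^*] on [d] states. This map is injective on the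
   image of every element of [J_X(F)]: a long word of [F] sends two states with
   the same image to states that differ by a factor lying in [Z^* ∩ F], hence in
   [X^*]. An element of a maximal subgroup of [J_X(F)] is therefore determined by
   any element of [G] that acts like it.

   If [hat h] maps [H] onto [G], then the image of the identity of [H] covers all
   the [d] states. This gives the [F]-degree, and it identifies each maximal
   subgroup of [J_X(F)] with [G]; conjugation carries the surjectivity to the
   other maximal subgroups of [J(F)]. Conversely [hat phi_X] factors through
   [hat h] on [H], so by (ii) and (iii) the image of [H] in [G] has at least
   [#|G|] elements. *)

Set Implicit Arguments.
Unset Strict Implicit.
Unset Printing Implicit Defensive.

Local Open Scope classical_set_scope.
Local Open Scope card_scope.
Local Open Scope group_scope.

(** * Green's relations and finite monoids *)

Section Finiteness.

Lemma inj_finite (T U : Type) (f : T -> U) :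
  injective f -> finite_set [set: U] -> finite_set [set: T].
Proof. by move=> fI; apply: (finite_preimage (B := [set: U]) (in2W fI)). Qed.

Lemma finite_pigeonhole (T : Type) (s : nat -> T) : finite_set [set: T] ->
  exists i j, (0 < j)%N /\ s i = s (i + j)%N.
Proof.
move=> fT; apply: contrapT => nex; apply: infinite_nat.
apply: (@inj_finite _ _ s) => // i j.
wlog ij : i j / (i <= j)%N => [h|].
  by case: (leqP i j) => [/h //|/ltnW /h hh /esym /hh].
move=> sE; apply: contrapT => nij; apply: nex.
exists i, (j - i)%N; split; last by rewrite subnKC.
by rewrite subn_gt0 ltn_neqAle ij andbT; apply/eqP.
Qed.

(** The orbit of [y] repeats, and injectivity cancels the common iterates, so [y] itself is an
    iterate of [f]. *)
Lemma finite_injective_onto (T : Type) (f : T -> T) :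
  finite_set [set: T] -> injective f -> forall y, exists x, f x = y.
Proof.
move=> fT fI y; have [i [j [jp]]] := finite_pigeonhole (fun i => iter i f y) fT.
case: j jp => // j _.
elim: i => [/esym yE|i IH]; first by exists (iter j f y).
by rewrite addSn !iterS => /fI /IH.
Qed.

Lemma finite_encoding (T : Type) : finite_set [set: T] ->
  exists n (e : T -> 'I_n.+1), injective e.
Proof.
(* The spare element of ['I_n.+1] makes [inord] available even when [T] is empty. *)
case=> n /card_set_bijP [f [fn fI _]]; exists n, (fun t => inord (f t)).
have fle t : (f t < n.+1)%N by apply/leqW/(fn t).
by move=> x y /(congr1 val); rewrite /= !inordK // => /fI; rewrite !inE; apply.
Qed.

Lemma finite_range_factor (T : Type) (U : choiceType) (I : Type)
    (f : T -> U) (c : T -> I) : finite_set [set: I] ->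
  (forall x y, c x = c y -> f x = f y) -> finite_set (range f).
Proof.
move=> fI cf; have [[u0 _]|nU] := pselect (exists u : U, True); last first.
  by apply: (sub_finite_set _ (finite_set0 U)) => y _; apply: nU; exists y.
have gE x : xget u0 [set y | exists2 x', c x' = c x & f x' = y] = f x.
  by apply: xget_unique => [|_ [x' /cf -> <-]]; first by exists x.
apply: (@sub_finite_set _ _
  ((fun i => xget u0 [set y | exists2 x, c x = i & f x = y]) @` range c)).
  by move=> _ [x _ <-]; exists (c x); [exists x | exact: gE].
by apply: finite_image; exact: sub_finite_set fI.
Qed.

Lemma finite_partial_maps (Q : Type) : finite_set [set: Q] ->
  finite_set [set: Q -> option Q].
Proof.
move=> /finite_encoding [n [e eI]].
pose c (f : Q -> option Q) : {ffun 'I_n.+1 -> option 'I_n.+1} :=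
  [ffun i => if pselect (exists x, e x = i) is left p
             then omap e (f (projT1 (cid p))) else None].
apply: (@inj_finite _ _ c); last exact: finite_finset.
move=> f g /ffunP cE; apply/funext => x; move: (cE (e x)); rewrite !ffunE.
case: pselect => [p|[]]; last by exists x.
case: (cid p) => y /= /eI ->.
by case: (f x) => [a|]; case: (g x) => [b|] //= [] // /eI ->.
Qed.
End Finiteness.

Local Notation factor := Defs.factor (only parsing).

(** * Group H-classes and conjugacy of idempotents *)

Section GreenTheory.
Context {M : monoidType}.
Implicit Types (x y z e f : M) (H J : set M).

Lemma factor_trans x y z : factor x y -> factor y z -> factor x z.
Proof.
by case=> a [b ->] [c [d' ->]]; exists (c * a), (b * d'); rewrite !mulgA.
Qed.

Lemma Jrel_sym x y : Jrel x y -> Jrel y x.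
Proof. by case. Qed.

Lemma Jrel_trans x y z : Jrel x y -> Jrel y z -> Jrel x z.
Proof. by case=> xy yx [yz zy]; split; apply: factor_trans; eauto. Qed.

Lemma Hrel_sym x y : Hrel x y -> Hrel y x.
Proof. by case=> -[? ?] [? ?]. Qed.

Lemma Hrel_trans x y z : Hrel x y -> Hrel y z -> Hrel x z.
Proof.
case=> -[[a ay] [b bx]] [[a' ay'] [b' bx']].
case=> -[[c cy] [d dx]] [[c' cy'] [d' dx']].
split; split.
- by exists (a * c); rewrite cy ay mulgA.
- by exists (d * b); rewrite mulgA -dx.
- by exists (c' * a'); rewrite cy' ay' mulgA.
- by exists (b' * d'); rewrite -mulgA -dx'.
Qed.

Lemma Hrel_Jrel x y : Hrel x y -> Jrel x y.
Proof.
case=> -[[a ->] [b bx]] _; split; first by exists 1, a; rewrite mul1g.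
by exists 1, b; rewrite mul1g.
Qed.

(** The H-class of an idempotent [e] is the group of units of the local monoid at [e]. Compressing
    by [e] the two factors that bring [y] back to [e] gives a right and a left inverse, which
    coincide. *)
Lemma Hrel_idemP e y : e * e = e ->
  Hrel e y <-> [/\ e * y = y, y * e = y &
                   exists2 z, Hrel e z & y * z = e /\ z * y = e].
Proof.
move=> ee; split; last first.
  case=> ey ye [z _ [yz zy]]; split; split; first by exists y.
  - by exists z.
  - by exists y.
  - by exists z.
case=> -[[a ay] [b bx]] [[a' ay'] [b' bx']].
have ey : e * y = y by rewrite ay mulgA ee.
have ye : y * e = y by rewrite ay' -mulgA ee.
split=> //.
have yz : y * (e * b * e) = e by rewrite !mulgA ye -bx ee.
have zy : (e * b' * e) * y = e by rewrite -!mulgA ey -bx' ee.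
have zz : e * b' * e = e * b * e.
  transitivity (e * b' * e * (y * (e * b * e))); first by rewrite yz -!mulgA ee.
  by rewrite mulgA zy !mulgA ee.
exists (e * b * e); last by split => //; rewrite -zz.
split; split; [by exists (b * e); rewrite mulgA| | by exists (e * b)|].
- by exists y; rewrite -zz.
- by exists y.
Qed.

Lemma Hclass_group e : e * e = e -> is_group [set y | Hrel e y].
Proof.
move=> ee; have eH : Hrel e e by split; split; exists e; rewrite ee.
split; last first.
  exists e => //= x /(Hrel_idemP _ ee) [ex xe [z ez [xz zx]]].
  by split=> //; exists z.
move=> x y /= /(Hrel_idemP _ ee) [ex xe [x' hx' [xx' x'x]]].
case/(Hrel_idemP _ ee) => [ey ye [y' hy' [yy' y'y]]].
have [ex' x'e _] := (Hrel_idemP _ ee).1 hx'.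
have [ey' y'e _] := (Hrel_idemP _ ee).1 hy'.
have xy : x * y * (y' * x') = e by rewrite -mulgA (mulgA y) yy' ex'.
have yx : y' * x' * (x * y) = e by rewrite -mulgA (mulgA x') x'x ey.
split; split; [exists (x * y)|exists (y' * x')|exists (x * y)|exists (y' * x')].
- by rewrite mulgA ex.
- by rewrite xy.
- by rewrite -mulgA ye.
- by rewrite yx.
Qed.

Lemma maximal_subgroup_idem J e :
  J e -> e * e = e -> maximal_subgroup_in J [set y | Hrel e y].
Proof. by move=> Je ee; split; [exists e | exact: Hclass_group]. Qed.

Lemma maximal_subgroupE J H : maximal_subgroup_in J H ->
  (forall x y, J x -> Jrel x y -> J y) ->
  exists e, [/\ J e, e * e = e & H = [set y | Hrel e y]].
Proof.
move=> [[x Jx HE] [_ [e He eP]]] Jcl; exists e.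
have xe : Hrel x e by move: He; rewrite HE.
split; first exact: Jcl Jx (Hrel_Jrel xe).
  by case: (eP _ He).
rewrite HE; apply/seteqP; split=> y /= h; last exact: Hrel_trans h.
exact: Hrel_trans (Hrel_sym xe) h.
Qed.

(* Satisfied by finite monoids and inherited by their projective limits; it
   replaces stability in the proof that [J]-equivalent idempotents are
   conjugate. *)
Definition idem_stable := forall e x a b : M,
  e * e = e -> x * x = x -> e * x = x -> x * e = x -> e = a * x * b -> x = e.

(** If [f = a * e * b], then [c = f * a * e] and [d = e * b * f] satisfy [c * d = f], so [d * c] is
    an idempotent below [e]. Since [e] is a multiple of [f = c * (d * c) * d], stability gives
    [d * c = e]. *)
Lemma idem_conj e f : idem_stable -> e * e = e -> f * f = f -> Jrel e f ->
  exists c d, [/\ c * d = f, d * c = e,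
    f * c = c /\ c * e = c & e * d = d /\ d * f = d].
Proof.
move=> st ee ff [[a [b fE]] [a' [b' eE]]].
set c := f * a * e; set d := e * b * f.
have cd : c * d = f.
  by rewrite /c /d !mulgA -(mulgA (f * a)) ee -(mulgA f) -(mulgA f) -fE !ff.
have fc : f * c = c by rewrite /c !mulgA ff.
have ce : c * e = c by rewrite /c -!mulgA ee.
have ed : e * d = d by rewrite /d !mulgA ee.
have df : d * f = d by rewrite /d -!mulgA ff.
clearbody c d; exists c, d; split=> //; apply: (st e (d * c) (a' * c) (d * b')) => //.
- by rewrite -mulgA (mulgA c) cd fc.
- by rewrite mulgA ed.
- by rewrite -mulgA ce.
- have cdcd : c * (d * c) * d = f by rewrite mulgA cd -mulgA cd ff.
  by rewrite {1}eE -{1}cdcd !mulgA.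
Qed.

Lemma Hrel_conj e f c d u : e * e = e -> f * f = f -> c * d = f -> d * c = e ->
  f * c = c -> d * f = d -> Hrel e u -> Hrel f (c * u * d).
Proof.
move=> ee ff cd dc fc df.
move=> /(Hrel_idemP _ ee) [eu ue [u' hu' [uu' u'u]]].
have [eu' u'e _] := (Hrel_idemP _ ee).1 hu'.
have xy : (c * u * d) * (c * u' * d) = f.
  rewrite -!mulgA (mulgA d) dc (mulgA e) eu' (mulgA u) uu' -dc -!mulgA cd df cd.
  by [].
have yx : (c * u' * d) * (c * u * d) = f.
  rewrite -!mulgA (mulgA d) dc (mulgA e) eu (mulgA u') u'u -dc -!mulgA cd df cd.
  by [].
split; split; [exists (c * u * d)|exists (c * u' * d)|
               exists (c * u * d)|exists (c * u' * d)] => //.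
  by rewrite !mulgA fc.
by rewrite -!mulgA df.
Qed.

(** Two powers of [y] agree; cancelling the smaller one by its left inverse shows that a positive
    power of [y] equals [e]. *)
Lemma finite_right_inverse (fM : finite_set [set: M]) e a y :
  e * e = e -> e * y = y -> y * e = y -> a * y = e ->
  exists z, y * z = e.
Proof.
move=> ee ey ye aye.
have [i [j [ij yij]]] := finite_pigeonhole (fun i => y ^+ i.+1) fM.
have ayn n : exists a', a' * y ^+ n.+1 = e.
  elim: n => [|n [a' IH]]; first by exists a; rewrite expg1.
  by exists (a * a'); rewrite expgSr mulgA -(mulgA a) IH -mulgA ey.
have [a' a'y] := ayn i.
have yn n : e * y ^+ n.+1 = y ^+ n.+1 by rewrite expgS mulgA ey.
case: j ij yij => // j _ yij.
exists (y ^+ j); rewrite -expgS -yn -a'y -mulgA -expgnDr addSn -yij //.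
Qed.

(** From [e = a * x * b], the element [x * b * e] has the left inverse [e * a], hence also a right
    inverse [z]. Then [x * e = x * x * b * e * z = e]. *)
Lemma finite_idem_stable : finite_set [set: M] -> idem_stable.
Proof.
move=> fM e x a b ee xx ex xe eE.
have [z yz] : exists z, (x * b * e) * z = e.
  apply: (@finite_right_inverse fM e (e * a)) => //.
  - by rewrite !mulgA ex.
  - by rewrite -!mulgA ee.
  - by rewrite !mulgA -(mulgA e a x) -(mulgA e _ b) -eE !ee.
rewrite -xe -yz !mulgA xx //.
Qed.
End GreenTheory.

Section GreenMorphism.
Context {M N : monoidType} (p : M -> N) (pm : monoid_morphism p).

Lemma morph_Jrel x y : Jrel x y -> Jrel (p x) (p y).
Proof.
by case=> -[a [b yE]] [c [d xE]]; split;
  [exists (p a), (p b); rewrite yE|exists (p c), (p d); rewrite xE]; rewrite !pm.2.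
Qed.

Lemma morph_Hrel x y : Hrel x y -> Hrel (p x) (p y).
Proof.
case=> -[[a ay] [b bx]] [[a' ay'] [b' bx']]; split; split.
- by exists (p a); rewrite -pm.2 -ay.
- by exists (p b); rewrite -pm.2 -bx.
- by exists (p a'); rewrite -pm.2 -ay'.
- by exists (p b'); rewrite -pm.2 -bx'.
Qed.
End GreenMorphism.

(** * Group codes *)

(** The bijection [k] sends a value of [f] to the value of [g] at any preimage. *)
Lemma card_range_ker (T U V : choiceType) (f : T -> U) (g : T -> V) :
  (forall x y, f x = f y <-> g x = g y) -> range f #= range g.
Proof.
move=> fg; have [[t0 _]|nT] := pselect (exists t : T, True); last first.
  have nr (W : choiceType) (k : T -> W) : range k = set0.
    by apply/seteqP; split=> // y [t]; case: nT; exists t.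
  by rewrite !nr.
pose k u := g (xget t0 [set x | f x = u]).
have kE x : k (f x) = g x.
  by rewrite /k; case: xgetP => [y _ /= /fg //|/(_ x)]; case.
apply: (card_eq_trans (B := k @` range f)).
  apply/card_esym/inj_card_eq => _ _ /set_mem [x _ <-] /set_mem [y _ <-].
  by rewrite !kE => /fg.
suff -> : k @` range f = range g by [].
apply/seteqP; split=> [_ [_ [x _ <-] <-]|_ [x _ <-]]; first by exists x; rewrite ?kE.
by exists (f x); [exists x | exact: kE].
Qed.

(** * Factorizations over a code *)

Section Star.
Context {A : finType}.
Implicit Types (X : set (seq A)) (u v w x : seq A).

Lemma star_nil X : star X [::].
Proof. by exists [::]. Qed.

Lemma star_gen X x : X x -> star X x.
Proof. by move=> Xx; exists [:: x]; rewrite /= ?cats0 // => y /[1!inE] /eqP ->. Qed.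

Lemma star_cat X u v : star X u -> star X v -> star X (u ++ v).
Proof.
move=> [s sX ->] [t tX ->]; exists (s ++ t); last by rewrite flatten_cat.
by move=> x; rewrite mem_cat => /orP[/sX|/tX].
Qed.

Lemma star_ind X (P : seq A -> Prop) : P [::] ->
  (forall x w, X x -> star X w -> P w -> P (x ++ w)) -> forall w, star X w -> P w.
Proof.
move=> P0 PS _ [s sX ->]; elim: s sX => //= x s IH sX.
have sX' y : y \in s -> X y by move=> ys; apply: sX; rewrite inE ys orbT.
by apply: PS; [apply: sX; rewrite mem_head | exists s | exact: IH].
Qed.

Lemma star_inv X w : ~ X [::] -> star X w -> w <> [::] ->
  exists x w', [/\ w = x ++ w', X x & star X w'].
Proof. by move=> X0; elim/star_ind => // x w' Xx Xw' _ _; exists x, w'. Qed.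

Lemma star_inv_suffix X w : star X w -> w <> [::] ->
  exists w' x, w = w' ++ x /\ X x.
Proof.
move=> [s sX ->]; case/lastP: s sX => // s x sX _.
exists (flatten s), x; rewrite -cats1 flatten_cat /= cats0; split=> //.
by apply: sX; rewrite mem_rcons mem_head.
Qed.

Lemma star_sub X Y : X `<=` Y -> star X `<=` star Y.
Proof. by move=> XY w [s sX ->]; exists s => // x /sX /XY. Qed.

Lemma residual_cat (S : set (seq A)) u v :
  residual S (u ++ v) = residual (residual S u) v.
Proof. by apply/seteqP; split=> w; rewrite /residual /= catA. Qed.

(** Code words are peeled off the front until none is left. With its mirror image below, this
    completes a cut of a word into a parse. *)
Lemma star_factor_prefix X w : ~ X [::] ->
  exists x q, [/\ w = x ++ q, star X x & forall y, X y -> ~~ prefix y q].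
Proof.
move=> X0; have [n] := ubnP (size w); elim: n w => // n IH w /ltnSE wn.
have [[y Xy /prefixP [w' wE]]|np] := pselect (exists2 y, X y & prefix y w).
  have [|x [q [w'E xX qX]]] := IH w'.
    apply: leq_trans wn; rewrite wE size_cat -[ltnLHS]add0n ltn_add2r lt0n.
    by apply/eqP => /size0nil y0; apply: X0; rewrite -y0.
  exists (y ++ x), q; rewrite wE w'E catA; split=> //.
  by apply: star_cat => //; apply: star_gen.
exists [::], w; split=> //; first exact: star_nil.
by move=> y Xy; apply/negP => yw; apply: np; exists y.
Qed.

Lemma star_factor_suffix X w : ~ X [::] ->
  exists p x, [/\ w = p ++ x, star X x & forall y, X y -> ~~ suffix y p].
Proof.
move=> X0; have [n] := ubnP (size w); elim: n w => // n IH w /ltnSE wn.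
have [[y Xy /suffixP [w' wE]]|np] := pselect (exists2 y, X y & suffix y w).
  have [|p [x [w'E xX pX]]] := IH w'.
    apply: leq_trans wn; rewrite wE size_cat -[ltnLHS]addn0 ltn_add2l lt0n.
    by apply/eqP => /size0nil y0; apply: X0; rewrite -y0.
  exists p, (x ++ y); rewrite wE w'E catA; split=> //.
  by apply: star_cat => //; apply: star_gen.
exists w, [::]; rewrite cats0; split=> //; first exact: star_nil.
by move=> y Xy; apply/negP => yw; apply: np; exists y.
Qed.
End Star.

Section SyntacticMonoid.
Context {A : finType} (L : set (seq A)).

Lemma synt_projP u v :
  synt_proj L u = synt_proj L v <-> forall x y, L (x ++ u ++ y) <-> L (x ++ v ++ y).
Proof.
split=> [/(@eqquotP _ _ (synt_monoid L)) /asboolP //|uv].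
by apply/(@eqquotP _ _ (synt_monoid L))/asboolP.
Qed.

Lemma synt_proj_morphism : monoid_morphism (synt_proj L : seq A -> synt_monoid L).
Proof. by split=> // u v; rewrite /= synt_projM. Qed.

Lemma synt_proj_onto (g : synt_monoid L) : exists w, synt_proj L w = g.
Proof. by exists (repr g); rewrite /synt_proj reprK. Qed.

(** The syntactic congruence read on the minimal automaton: equivalent words act alike on every
    residual. *)
Lemma synt_proj_residual u v : synt_proj L u = synt_proj L v <->
  forall x, residual L (x ++ u) = residual L (x ++ v).
Proof.
rewrite synt_projP; split=> [uv x|uv x y].
  by apply/seteqP; split=> y; rewrite /residual /= -!catA => /uv.
by move: (congr1 (@^~ y) (uv x)); rewrite /residual /= -!catA => ->.
Qed.
End SyntacticMonoid.

(** * The group automaton of a group code *)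

Section GroupCode.
Context {A : finType} {Z : set (seq A)} {d : nat} (hZ : group_code Z d).
Local Notation rho := (residual (star Z)).
Local Notation h := (synt_proj (star Z)).
Implicit Types (u v w x y : seq A).

Lemma group_code_nil : ~ Z [::].
Proof. by case: hZ => -[]. Qed.

(** The residual by [u] amounts to the right coset of [g u] modulo [K], so every word permutes the
    residuals. The test word [t ++ s] extracts [g u / g v] from the residual by [u ++ y]. *)
Lemma rho_cancel y u v : rho (u ++ y) = rho (v ++ y) -> rho u = rho v.
Proof.
case: hZ => _ [G [g [K [gm gs Kg _ ZE]]]] uv.
have [t _ gt] : range g (g y)^-1 by apply: gs.
suff gK : (g u / g v) \in K.
  have [[K1 KM] KV] := (Kg.1, group_closedM Kg, group_closedV Kg).
  apply/seteqP; split=> x; rewrite /residual ZE /= !gm.2 => xK.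
    by have := KM _ _ (KV _ gK) xK; rewrite invgM invgK -mulgA mulKg.
  by have := KM _ _ gK xK; rewrite -mulgA mulKg.
have [s _ gs'] : range g (g v)^-1 by apply: gs.
have : rho (v ++ y) (t ++ s).
  rewrite /residual ZE /= !gm.2 gt gs' -mulgA (mulgA (g y)) mulgV mul1g mulgV.
  exact: Kg.1.
rewrite -uv /residual ZE /= !gm.2 gt gs' -mulgA (mulgA (g y)) mulgV mul1g.
by [].
Qed.

Lemma rho_cat u v w : rho u = rho v -> rho (u ++ w) = rho (v ++ w).
Proof. by rewrite !residual_cat => ->. Qed.

Lemma rho_nilP u : rho u = rho [::] <-> star Z u.
Proof.
split=> [uZ|Zu].
  have : rho [::] [::] by apply: star_nil.
  by rewrite -uZ /residual /= cats0.
case: hZ => _ [G [g [K [gm gs Kg _ ZE]]]].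
have [[K1 KM] KV] := (Kg.1, group_closedM Kg, group_closedV Kg).
move: Zu; rewrite /residual ZE /= => uK.
apply/seteqP; split=> x; rewrite /= !gm.2 => xK; last exact: KM.
by have := KM _ _ (KV _ uK) xK; rewrite mulKg.
Qed.

Lemma synt_inverse u : exists v, h (u ++ v) = h [::] /\ h (v ++ u) = h [::].
Proof.
case: hZ => _ [G [g [K [gm gs Kg _ ZE]]]].
have [v _ gv] : range g (g u)^-1 by apply: gs.
exists v; split; apply/synt_projP => x y; rewrite ZE /= !gm.2 gv.
  by rewrite mulgV mul1g.
by rewrite mulVg mul1g.
Qed.

Lemma rho_card : range rho #= `I_d.
Proof.
case: (hZ) => _ [G [g [K [gm gs Kg dE ZE]]]].
have [[K1 KM] KV] := (Kg.1, group_closedM Kg, group_closedV Kg).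
apply: card_eq_trans dE.
pose cos (x : G) : set G := [set z | z / x \in K].
have -> : range cos = range (cos \o g).
  apply/seteqP; split=> [_ [x _ <-]|_ [w _ <-]]; last by exists (g w).
  by have [w _ <-] := gs x I; exists w.
apply: card_range_ker => u v; split=> [uv|/= uv].
  have gK : (g u / g v) \in K.
    have [t _ gt] : range g (g v)^-1 by apply: gs.
    have : rho v t by rewrite /residual ZE /= gm.2 gt mulgV.
    by rewrite -uv /residual ZE /= gm.2 gt.
  apply/seteqP; split=> z; rewrite /cos /= => zK.
    by have := KM _ _ zK gK; rewrite -mulgA mulKg.
  by have := KM _ _ zK (KV _ gK); rewrite invgM invgK -mulgA mulKg.
have : cos (g u) (g u) by rewrite /cos /= mulgV.
rewrite uv /cos /= => gK.
apply/seteqP; split=> x; rewrite /residual ZE /= !gm.2 => xK.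
  by have := KM _ _ (KV _ gK) xK; rewrite invgM invgK -mulgA mulKg.
by have := KM _ _ gK xK; rewrite -mulgA mulKg.
Qed.

Lemma rho_finite : finite_set (range rho).
Proof. by exists d; exact: rho_card. Qed.

(** A syntactic class is determined by its action on the finitely many residuals. *)
Lemma synt_finite : finite_set [set: synt_monoid (star Z)].
Proof.
have -> : [set: synt_monoid (star Z)] = range h.
  by apply/seteqP; split=> // g _; have [w <-] := synt_proj_onto g; exists w.
have fQ : finite_set [set: range rho].
  by rewrite (eq_finite_set (card_setT _)); exact: rho_finite.
have st (q : range rho) u : residual (val q) u \in range rho.
  case: (set_mem (valP q)) => w _ <-; apply/mem_set.
  by exists (w ++ u) => //; rewrite residual_cat.
pose c u (q : range rho) : option (range rho) :=
  Some (exist (fun S => S \in range rho) _ (st q u)).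
apply: (finite_range_factor (c := c)); first exact: finite_partial_maps.
move=> u v cuv; apply/synt_proj_residual => x.
have xr : rho x \in range rho by apply/mem_set; exists x.
have [] := congr1 (@^~ (exist (fun S => S \in range rho) _ xr)) cuv.
by rewrite !residual_cat.
Qed.
End GroupCode.

(** * Uniformly recurrent sets *)

Lemma leq_card_fset_inj (T U : choiceType) (S : set T) (S' : set U) (f : T -> U) :
  finite_set S' -> {in S &, injective f} -> f @` S `<=` S' ->
  (#|` fset_set S| <= #|` fset_set S'|)%N.
Proof.
move=> fS' fI fS.
have SS' : S #<= S'.
  by rewrite -(card_le_eql (inj_card_eq fI)); apply: subset_card_le.
have [m Sm] := card_le_finite SS' fS'.
have [n Sn] := fS'.
rewrite (card_fset_set Sm) (card_fset_set Sn) -card_le_II.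
by rewrite -(card_le_eql Sm) -(card_le_eqr Sn).
Qed.

Lemma eq_subset_leq_card (T : choiceType) (S S' : set T) :
  finite_set S' -> S `<=` S' -> (#|` fset_set S'| <= #|` fset_set S|)%N -> S = S'.
Proof.
move=> fS' SS' le; have fS := sub_finite_set SS' fS'.
apply: fset_set_inj => //; apply/eqP; rewrite eqEfcard le andbT.
by rewrite -fset_set_sub.
Qed.

Lemma finite_words (A : finType) n : finite_set [set w : seq A | (size w <= n)%N].
Proof.
apply: (@sub_finite_set _ _ (range (fun t : n.-bseq A => bseqval t))).
  by move=> w wn; exists (Bseq wn).
by apply: finite_image; exact: finite_finset.
Qed.

Lemma cat_levi (T : Type) (a b c d : seq T) : a ++ b = c ++ d ->
  (exists e, c = a ++ e /\ b = e ++ d) \/ (exists e, a = c ++ e /\ d = e ++ b).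
Proof.
elim: a c => [|x a IH] [|y c] /= E.
- by left; exists [::].
- by left; exists (y :: c).
- by right; exists (x :: a).
- by case: E => <- /IH [[e [-> ->]]|[e [-> ->]]]; [left|right]; exists e.
Qed.

Section UniformRecurrence.
Context {A : finType} {F : set (seq A)} (hF : uniformly_recurrent F).
Implicit Types (u v w x y z : seq A).

Lemma ur_factor x w y : F (x ++ w ++ y) -> F w.
Proof. by case: hF => -[_ Ff] _ _ /Ff; apply; apply/infixP; exists x, y. Qed.

Lemma ur_prefix w y : F (w ++ y) -> F w.
Proof. exact: (@ur_factor [::]). Qed.

Lemma ur_suffix x w : F (x ++ w) -> F w.
Proof. by rewrite -{1}[w]cats0; exact: ur_factor. Qed.

Lemma ur_words n : exists2 w, F w & size w = n.
Proof.
have [w Fw wn] : exists2 w, F w & (n <= size w)%N.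
  apply: contrapT => nw; case: hF => _ Finf _; apply: Finf.
  apply: sub_finite_set (finite_words A n) => w Fw /=.
  by rewrite leqNgt; apply/negP => nw'; apply: nw; exists w => //; exact: ltnW.
exists (take n w); last by rewrite size_takel.
by apply: (@ur_prefix _ (drop n w)); rewrite cat_take_drop.
Qed.

Lemma ur_long x : F x -> exists n, forall w, F w -> (n <= size w)%N ->
  exists p q, w = p ++ x ++ q.
Proof.
case: hF => _ _ ur /ur [n _ nP]; exists n => w Fw nw.
have : infix x (take n w).
  apply: nP; last by rewrite size_takel.
  by apply: (@ur_prefix _ (drop n w)); rewrite cat_take_drop.
move=> /infixP [p [q E]]; exists p, (q ++ drop n w).
by rewrite -[LHS](cat_take_drop n) E -!catA.
Qed.

(** A long enough word of [F] splits into a first part containing [x] and a second part containing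
    [z]. *)
Lemma ur_recurrent x z : F x -> F z -> exists y, F (x ++ y ++ z).
Proof.
move=> /ur_long [n nP] /ur_long [m mP].
have [w Fw wnm] := ur_words (n + m).
have Fc : F (take n w ++ drop n w) by rewrite cat_take_drop.
have [|p [q pE]] := nP _ (ur_prefix Fc); first by rewrite size_takel // wnm leq_addr.
have [|p' [q' qE]] := mP _ (ur_suffix Fc); first by rewrite size_drop wnm addKn.
exists (q ++ p'); apply: (@ur_factor p _ q').
by move: Fc; rewrite pE qE !catA.
Qed.

Lemma ur_extend x n : F x -> exists2 y, (n <= size y)%N & F (x ++ y).
Proof.
move=> Fx; have [w Fw wn] := ur_words n.
have [y Fxyw] := ur_recurrent Fx Fw; exists (y ++ w) => //.
by rewrite size_cat wn leq_addl.
Qed.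
End UniformRecurrence.

(** * The code cut out of [F] by a group code *)

Section Intersection.
Context {A : finType} {F Z : set (seq A)} {d : nat}.
Context (hF : uniformly_recurrent F) (hZ : group_code Z d).
Local Notation X := (Z `&` F).
Local Notation rho := (residual (star Z)).
Implicit Types (u v w x y z : seq A).

(** The initial state belongs to this set exactly when no nonempty prefix of [w] lies in
    [star Z]. *)
Let avoiding w : set (set (seq A)) :=
  [set s | range rho s /\
     forall p, prefix p w -> p <> [::] -> residual s p <> rho [::]].

Let avoiding_finite w : finite_set (avoiding w).
Proof. by apply: sub_finite_set (rho_finite hZ) => s []. Qed.

Let avoiding_prefix w y : avoiding (w ++ y) `<=` avoiding w.
Proof.
move=> s [rs sP]; split=> // p pw; apply: sP.
exact: prefix_trans pw (prefix_prefix _ _).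
Qed.

Let avoiding_suffix y w : residual ^~ y @` avoiding (y ++ w) `<=` avoiding w.
Proof.
move=> _ [s [[u _ <-] sP] <-]; split=> [|p pw p0].
  by exists (u ++ y); rewrite ?residual_cat.
rewrite -residual_cat; apply: sP; last by case: (y).
by case/prefixP: pw => q ->; rewrite catA prefix_prefix.
Qed.

Let avoiding_inj y w : {in avoiding w &, injective (residual ^~ y)}.
Proof.
move=> _ _ /set_mem [[u _ <-] _] /set_mem [[v _ <-] _].
by rewrite -!residual_cat => /(rho_cancel hZ).
Qed.

Let X_nil : ~ X [::].
Proof. by case=> /(group_code_nil hZ). Qed.

(** The code words in the factorization of [w] are factors of [w], hence lie in [F]. *)
Lemma star_factor_F w : star Z w -> F w -> star X w.
Proof.
move: w; apply: star_ind => [|x v Zx _ IH Fxv]; first by move=> _; exact: star_nil.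
apply: star_cat; last by apply: IH; exact: ur_suffix Fxv.
by apply: star_gen; split=> //; exact: ur_prefix Fxv.
Qed.

(* Let [w0] in [F] be avoided by the fewest states. If the initial state avoids a
   word [w] of [F] that contains [w0], then returning from [w] to [w] permutes
   the states avoiding [w], so one of them reaches the initial state: absurd. *)
Lemma X_return : exists N, forall w, F w -> (N <= size w)%N ->
  exists x w', w = x ++ w' /\ X x.
Proof.
pose c w := #|` fset_set (avoiding w)|.
have [w0 Fw0 w0P] : exists2 w0, F w0 & forall w, F w -> (c w0 <= c w)%N.
  have ex : exists n, `[< exists2 w, F w & c w = n >].
    have [w Fw _] := ur_words hF 0.
    by exists (c w); apply/asboolP; exists w.
  case: (ex_minnP ex) => n /asboolP [w0 Fw0 <-] nP; exists w0 => // w Fw.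
  by apply: nP; apply/asboolP; exists w.
have [N NP] := ur_long hF Fw0; exists N.+1 => w Fw Nw.
(* As [w = p ++ w0 ++ q], reading [p] maps [avoiding w] injectively into [avoiding w0], so [w] is
   minimal as well. *)
have w_min v : F v -> (c w <= c v)%N.
  move=> Fv; have [p [q wE]] := NP _ Fw (ltnW Nw).
  apply: leq_trans (w0P _ Fv).
  apply: leq_trans (leq_card_fset_inj (avoiding_finite w0) (@avoiding_inj p _)
    (@avoiding_suffix p w0)).
  rewrite /c wE; apply: (@leq_card_fset_inj _ _ _ _ id) => //.
  by rewrite image_id catA; exact: avoiding_prefix.
have w_nil : w <> [::] by move=> w0'; rewrite w0' in Nw.
have [y Fwyw] := ur_recurrent hF Fw Fw.
have nav : ~ avoiding w (rho [::]).
  have eqB : avoiding (w ++ y ++ w) = avoiding w.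
    apply: eq_subset_leq_card (avoiding_finite w) (@avoiding_prefix _ _) _.
    exact: w_min.
  (* By [eqB], reading [w ++ y] maps [avoiding w] into itself; it does so injectively, hence
     onto. *)
  have onto : residual ^~ (w ++ y) @` avoiding w = avoiding w.
    apply: eq_subset_leq_card (avoiding_finite w) _ _.
      by rewrite -{1}eqB catA; exact: avoiding_suffix.
    apply: (@leq_card_fset_inj _ _ _ _ (residual ^~ (w ++ y))) => //.
      by apply: finite_image.
  rewrite -onto -{1}eqB => -[s [_ sP]]; apply: sP; first by rewrite catA prefix_prefix.
  by case: (w) w_nil.
have [p [q [wE pZ p0]]] : exists p q, [/\ w = p ++ q, star Z p & p <> [::]].
  apply: contrapT => nex; apply: nav; split; first by exists [::].
  move=> p /prefixP [q wE] p0 pr; apply: nex; exists p, q; split=> //.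
  by apply/(rho_nilP hZ); rewrite -pr -residual_cat.
have pX : star X p by apply: star_factor_F => //; apply: (ur_prefix hF (y := q)); rewrite -wE.
have [x [w' [pE Xx _]]] := star_inv X_nil pX p0.
by exists x, (w' ++ q); rewrite wE pE catA.
Qed.

Lemma X_bifix : bifix_code X.
Proof.
case: hZ => -[Z0 Zp Zs] _; split=> // x y [Zx _] [Zy _]; first exact: Zp.
exact: Zs.
Qed.

(** In a code word longer than the bound of [X_return], the prefix of that length would begin with a
    code word, against the prefix property. *)
Lemma X_bounded : exists N, forall x, X x -> (size x <= N)%N.
Proof.
have [N NP] := X_return; exists N => x Xx; rewrite leqNgt; apply/negP => Nx.
have Ft : F (take N x).
  by apply: (ur_prefix hF (y := drop N x)); rewrite cat_take_drop; case: Xx.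
have [|y [w' [tE Xy]]] := NP _ Ft; first by rewrite size_takel // ltnW.
have yx : prefix y x.
  by apply/prefixP; exists (w' ++ drop N x); rewrite catA -tE cat_take_drop.
have [_ Xp _] := X_bifix; have yE := Xp _ _ Xy Xx yx.
have : (size y <= N)%N.
  by rewrite -(size_takel (ltnW Nx)) tE size_cat leq_addr.
by rewrite yE leqNgt Nx.
Qed.

(** A word [y] of a larger code extends in [F] to a word beginning with some [x] in [X]. Then [x]
    and [y] are comparable for the prefix order, hence equal. *)
Lemma X_maximal : maximal_bifix_code F X.
Proof.
split; [exact: X_bifix|by move=> ? []|] => Y [Y0 Yp _] YF XY.
apply/seteqP; split=> // y Yy.
have [N NP] := X_return.
have [v vN Fyv] := ur_extend hF N (YF _ Yy).
have [|x [w' [E Xx]]] := NP _ Fyv.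
  by apply: leq_trans vN _; rewrite size_cat leq_addl.
case: (cat_levi E) => -[e [xE _]].
  by rewrite (Yp _ _ Yy (XY _ Xx)) // xE prefix_prefix.
by rewrite -(Yp _ _ (XY _ Xx) Yy) // xE prefix_prefix.
Qed.

Lemma star_X_completion u : F u -> exists t, star X (u ++ t).
Proof.
have [N NP] := X_return.
have [n] := ubnP (size u); elim: n u => // n IH u /ltnSE un Fu.
have [->|/eqP u0] := eqVneq u [::]; first by exists [::]; exact: star_nil.
have [v vN Fuv] := ur_extend hF N Fu.
have [|x [w' [E Xx]]] := NP _ Fuv.
  by apply: leq_trans vN _; rewrite size_cat leq_addl.
case: (cat_levi E) => -[e [uE _]].
  by exists e; rewrite -uE; exact: star_gen.
have [||t eX] := IH e.
- apply: leq_trans un; rewrite uE size_cat -[ltnLHS]add0n ltn_add2r lt0n.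
  by apply/eqP => /size0nil x0; apply: X_nil; rewrite -x0.
- by apply: (ur_suffix hF (x := x)); rewrite -uE.
by exists t; rewrite uE -catA; apply: star_cat => //; exact: star_gen.
Qed.
End Intersection.

(** * The minimal automaton of the intersection code *)

Section Automaton.
Context {A : finType} {L : set (seq A)}.

Lemma actP w (p q : states L) : act w p = Some q <-> residual (val p) w = val q.
Proof.
rewrite /act; split=> [|->]; last exact: valK.
by case: insubP => // r _ <- [->].
Qed.

Lemma act_def w (p : states L) :
  residual (val p) w !=set0 -> exists q, act w p = Some q.
Proof.
move=> ne; have st : residual (val p) w \in states L.
  apply/mem_set; split=> //; case: (set_mem (valP p)) => _ [u ->].
  by exists (u ++ w); rewrite residual_cat.
by exists (exist (fun S => S \in states L) _ st); apply/actP.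
Qed.

Lemma stateP (p : states L) :
  exists u, val p = residual L u /\ exists t, L (u ++ t).
Proof.
case: (set_mem (valP p)) => -[t pt] [u pE]; exists u; split=> //.
by exists t; rewrite pE in pt.
Qed.

Lemma trans_morphism : monoid_morphism (@trans A L).
Proof. by split=> // u v; apply/val_inj; exact: act_cat. Qed.

Lemma trans_onto (m : transition_monoid L) : exists w, trans L w = m.
Proof.
by case: (set_mem (valP m)) => w _ wm; exists w; apply: val_inj.
Qed.

Lemma val_transM (m m' : transition_monoid L) p :
  val (m * m') p = obind (val m') (val m p).
Proof. by []. Qed.

Lemma image_transM (m m' : transition_monoid L) :
  pmap_image (val (m * m')) `<=` pmap_image (val m').
Proof.
by move=> q [p]; rewrite val_transM; case: (val m p) => //= r rq; exists r.
Qed.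

Lemma transition_monoid_finite :
  finite_set (states L) -> finite_set [set: transition_monoid L].
Proof.
move=> fL; apply: (@inj_finite _ _ (fun m : transition_monoid L => val m)).
  exact: val_inj.
by apply: finite_partial_maps; rewrite (eq_finite_set (card_setT _)).
Qed.

Lemma card_image_factor (a m b : transition_monoid L) :
  pmap_image (val (a * m * b)) #<= pmap_image (val m).
Proof.
(* The image of [m] moved by [b] covers the new image; the default [p] only makes [b] total. *)
apply: card_le_trans (card_image_le (fun p => odflt p (val b p)) _).
apply: subset_card_le => q [p]; rewrite !val_transM.
case: (val a p) => //= r; case mr: (val m r) => [s|] //= sq.
by exists s; [exists r | rewrite sq].
Qed.
End Automaton.

(** * Comparison of the automata of [X^*] and [Z^*] *)

Section Code.
Context {A : finType} {F Z : set (seq A)} {d : nat}.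
Context (hF : uniformly_recurrent F) (hZ : group_code Z d).
Local Notation X := (Z `&` F).
Local Notation rho := (residual (star Z)).
Local Notation sigma := (residual (star X)).
Local Notation h := (synt_proj (star Z)).
Local Notation M := (transition_monoid (star X)).
Implicit Types (u v w x y z t : seq A) (p q r : states (star X)) (m f : M).

Let X_nil : ~ X [::].
Proof. by case=> /(group_code_nil hZ). Qed.

Lemma star_X_unitary u w : star X u -> star X (u ++ w) -> star X w.
Proof.
move: u; apply: star_ind => // x u Xx _ IH; rewrite -catA => xuwX.
apply: IH; have x0 : x ++ u ++ w <> [::] by case: (x) Xx => // /X_nil.
have [y [v [E Xy vX]]] := star_inv X_nil xuwX x0.
have [_ Xp _] := X_bifix hZ (F := F).
suff xy : x = y.
  by move: E; rewrite xy => /(congr1 (drop (size y))); rewrite !drop_size_cat // => ->.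
case: (cat_levi E) => -[e [yE _]].
  by apply: Xp => //; rewrite yE prefix_prefix.
by apply/esym/Xp => //; rewrite yE prefix_prefix.
Qed.

Lemma sigma_star u w : star X u -> sigma (u ++ w) = sigma w.
Proof.
move=> uX; apply/seteqP; split=> t; rewrite /residual /= -catA.
  exact: star_X_unitary.
exact: star_cat.
Qed.

(** This makes the map between the two automata well defined: the same [t] completes [u] and [v]
    into [star Z], and it cancels. *)
Lemma sigma_rho u v t : sigma u = sigma v -> star X (u ++ t) -> rho u = rho v.
Proof.
move=> uv utX; have vtX : star X (v ++ t) by rewrite -[star X _]/(sigma v t) -uv.
have XZ : star X `<=` star Z by apply: star_sub => ? [].
by apply: (rho_cancel hZ (y := t)); rewrite !(rho_nilP hZ _).2 //; exact: XZ.
Qed.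

(* The state of the group automaton of [Z] reached by the words reaching [p]. *)
Definition base p : set (seq A) := rho (xget [::] [set u | val p = sigma u]).

Lemma baseE p u : val p = sigma u -> base p = rho u.
Proof.
have [v [pv [t vt]]] := stateP p; move=> pu.
rewrite /base; case: xgetP => [w _ /= pw|/(_ u)]; last by case.
apply: (@sigma_rho _ _ t); first by rewrite -pw.
by rewrite -[star X _]/(sigma w t) -pw pv.
Qed.

Lemma base_range p : exists u, base p = rho u.
Proof. by eexists. Qed.

Lemma base_act w p q : act w p = Some q -> base q = residual (base p) w.
Proof.
have [u [pu _]] := stateP p.
by move=> /actP; rewrite pu -residual_cat (baseE pu) -residual_cat => /esym /baseE.
Qed.

(** A window at least as long as every code word meets a boundary of the factorization. *)
Lemma star_X_cut N u w t : (forall x, X x -> (size x <= N)%N) ->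
  (N <= size w)%N -> star X (u ++ w ++ t) ->
  exists w1 w2, [/\ w = w1 ++ w2, star X (u ++ w1) & star X (w2 ++ t)].
Proof.
move=> NX Nw; move E : (u ++ w ++ t) => v vX; move: v vX u E; apply: star_ind.
  move=> u /(congr1 size); rewrite !size_cat.
  case: (u) => //; case: (w) => //; case: (t) => // _.
  by exists [::], [::]; split=> //; exact: star_nil.
move=> x v Xx vX IH u /cat_levi [[e [xE E]]|[e [-> /esym/IH]]]; last first.
  move=> [w1 [w2 [-> ew1 w2t]]]; exists w1, w2; split=> //.
  by rewrite -catA; apply: star_cat => //; exact: star_gen.
have ew : (size e <= size w)%N.
  apply: leq_trans Nw; apply: leq_trans (NX _ Xx).
  by rewrite xE size_cat leq_addl.
exists e, (drop (size e) w).
have wE : w = e ++ drop (size e) w.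
  rewrite -{1}(cat_take_drop (size e) w); congr (_ ++ _).
  by move/(congr1 (take (size e))): E; rewrite takel_cat // take_size_cat.
split=> //; first by rewrite -xE; exact: star_gen.
suff -> : drop (size e) w ++ t = v by [].
move/(congr1 (drop (size e))): E; rewrite drop_cat drop_size_cat //.
case: ltnP => // h1 <-; rewrite drop_oversize // (_ : size e - size w = 0)%N ?drop0 //.
by apply/eqP; rewrite subn_eq0.
Qed.

(** A path with a long label passes through the initial state, so its end depends only on a suffix
    of the label. *)
Lemma act_cut N w p q : (forall x, X x -> (size x <= N)%N) -> (N <= size w)%N ->
  act w p = Some q ->
  exists w1 w2, [/\ w = w1 ++ w2, val q = sigma w2 & residual (base p) w1 = rho [::]].
Proof.
move=> NX Nw; have [u [pu _]] := stateP p.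
have [[t' qt] _] := set_mem (valP q); move=> /actP; rewrite pu -residual_cat => qE.
have : star X (u ++ w ++ t') by move: qt; rewrite -qE /residual /= -catA.
move=> /(star_X_cut NX Nw) [w1 [w2 [wE uw1 _]]].
exists w1, w2; split; first exact: wE.
  by rewrite -qE wE catA; exact: sigma_star.
rewrite (baseE pu) -residual_cat; apply/(rho_nilP hZ).
by apply: star_sub uw1 => ? [].
Qed.

Definition base_separated m : Prop := forall q r,
  pmap_image (val m) q -> pmap_image (val m) r -> base q = base r -> q = r.

(** Both states are reached from the initial state by suffixes of [w], the longer being [e] followed
    by the shorter. Equal bases put [e] in [star Z]; being a factor of [w], it lies in [star X] and
    does not change the state. *)
Lemma base_separated_long N w : (forall x, X x -> (size x <= N)%N) ->
  F w -> (N <= size w)%N -> base_separated (phiX X w).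
Proof.
move=> NX Fw Nw q r [p pq] [p' pr].
have [w1 [w2 [wE qE _]]] := act_cut NX Nw pq.
have [v1 [v2 [vE rE _]]] := act_cut NX Nw pr.
rewrite (baseE qE) (baseE rE) => qr; apply: val_inj; rewrite /= qE rE.
wlog [e E] : w1 w2 v1 v2 wE vE {qE rE} qr / exists e, w2 = e ++ v2.
  move=> hw; have := wE; rewrite {1}vE => /cat_levi [[e [_ E]]|[e [_ E]]].
    by apply/esym/(hw v1 v2 w1 w2) => //; exists e.
  by apply: (hw w1 w2 v1 v2) => //; exists e.
have eZ : star Z e.
  by apply/(rho_nilP hZ)/(rho_cancel hZ (y := v2)); rewrite -E.
rewrite E; apply: sigma_star; apply: (star_factor_F hF) => //.
by apply: (ur_factor hF (x := w1) (y := v2)); rewrite -E -wE.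
Qed.

Lemma X_states_finite : finite_set (states (star X)).
Proof.
have [N NX] := X_bounded hF hZ.
have cut u t : star X (u ++ t) ->
    exists u1 u2, [/\ u = u1 ++ u2, star X u1 & (size u2 <= N)%N].
  move E : (u ++ t) => v vX; move: v vX u E; apply: star_ind.
    by case=> // _; exists [::], [::]; split=> //; exact: star_nil.
  move=> x v Xx vX IH u /cat_levi [[e [xE _]]|[e [-> /esym/IH]]].
    exists [::], u; split=> //; first exact: star_nil.
    by apply: leq_trans (NX _ Xx); rewrite xE size_cat leq_addr.
  move=> [u1 [u2 [-> u1X u2N]]]; exists (x ++ u1), u2; rewrite catA; split=> //.
  by apply: star_cat => //; exact: star_gen.
apply: sub_finite_set (finite_image sigma (finite_words A N)).
move=> S [[t St] [u SE]]; move: St; rewrite SE => /cut [u1 [u2 [-> u1X u2N]]].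
by exists u2; rewrite ?sigma_star.
Qed.

Lemma X_images_finite m : finite_set (pmap_image (val m)).
Proof.
apply: (sub_finite_set (B := setT)) => //.
by rewrite (eq_finite_set (card_setT _)); exact: X_states_finite.
Qed.

Lemma X_transition_finite : finite_set [set: M].
Proof. exact/transition_monoid_finite/X_states_finite. Qed.

Lemma rank_leE m f : rank_le m f =
  (#|` fset_set (pmap_image (val m))| <= #|` fset_set (pmap_image (val f))|)%N.
Proof.
have [i mi] := X_images_finite m; have [j fj] := X_images_finite f.
rewrite /rank_le (card_fset_set mi) (card_fset_set fj) -card_le_II.
by rewrite -(card_le_eql mi) -(card_le_eqr fj).
Qed.

(** * Elements of minimal rank and their J-class *)

Lemma minimal_rank_exists : exists2 w, F w & minimal_rank F (phiX X w).
Proof.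
pose c w := #|` fset_set (pmap_image (val (phiX X w)))|.
have ex : exists n, `[< exists2 w, F w & c w = n >].
  have [w Fw _] := ur_words hF 0.
  by exists (c w); apply/asboolP; exists w.
case: (ex_minnP ex) => n /asboolP [w0 Fw0 <-] nP; exists w0 => //.
split; first by exists w0.
by move=> w Fw; rewrite rank_leE; apply: nP; apply/asboolP; exists w.
Qed.

Lemma minimal_rank_factor x w y : F (x ++ w ++ y) ->
  minimal_rank F (phiX X w) -> minimal_rank F (phiX X (x ++ w ++ y)).
Proof.
move=> Fxwy [_ wmin]; split; first by exists (x ++ w ++ y).
move=> v /wmin; apply: card_le_trans.
by rewrite /phiX !trans_morphism.2 mulgA; exact: card_image_factor.
Qed.

(** The section [s] picks a preimage under [y] of each state in the image of [w ++ y]. As the rank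
    cannot drop, [s] fills the whole image of [w], on which [y] is therefore defined and
    injective. *)
Lemma minimal_rank_act w y : F (w ++ y) -> minimal_rank F (phiX X w) ->
  (forall q, pmap_image (act w) q -> exists r, act y q = Some r) /\
  (forall q q', pmap_image (act w) q -> pmap_image (act w) q' ->
     act y q = act y q' -> q = q').
Proof.
move=> Fwy [_ wmin].
pose I0 := pmap_image (val (phiX X w)).
pose I1 := pmap_image (val (phiX X (w ++ y))).
pose s r := xget r [set q | I0 q /\ act y q = Some r].
have sP r : I1 r -> I0 (s r) /\ act y (s r) = Some r.
  move=> [p]; rewrite /= act_cat /mul /= /pmap_mul.
  case E: (act w p) => [q|] //= qr.
  rewrite /s; case: xgetP => [q' _ //|/(_ q)]; case; split=> //.
  by exists p.
have sI0 : s @` I1 = I0.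
  apply: eq_subset_leq_card; first exact: X_images_finite.
    by move=> _ [r /sP [? _] <-].
  apply: (@leq_trans #|` fset_set I1|).
    by rewrite -rank_leE; exact: wmin.
  apply: (@leq_card_fset_inj _ _ _ _ s) => //.
    by apply: finite_image; exact: X_images_finite.
  move=> r r' /set_mem /sP [_ E] /set_mem /sP [_ E'] ss.
  by move: E; rewrite ss E' => -[].
rewrite -[pmap_image _]/I0 -sI0; split.
  by move=> _ [r /sP [_ E] <-]; exists r.
by move=> _ _ [r /sP [_ E] <-] [r' /sP [_ E'] <-]; rewrite E E' => -[->].
Qed.

(** Extending [w0] by [y] to a long word gives separation, which returns to [w0] because [y] is
    injective on its image. It passes to [f] because [rho_cancel] undoes the action of the right
    factor [z]. *)
Lemma base_separated_JX f : JX F X f -> base_separated f.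
Proof.
case=> _ [[w0 Fw0 <-] wmin] [_ [a [b fE]]].
have [N NX] := X_bounded hF hZ.
have [y yN Fwy] := ur_extend hF N Fw0.
have Nwy : (N <= size (w0 ++ y))%N by rewrite size_cat (leq_trans yN) ?leq_addl.
have inj := base_separated_long NX Fwy Nwy.
have wmin' : minimal_rank F (phiX X w0) by split=> //; exists w0.
have [ydef yinj] := minimal_rank_act Fwy wmin'.
have inj0 : base_separated (phiX X w0).
  move=> q q' qI q'I qq'; have [r qr] := ydef _ qI; have [r' qr'] := ydef _ q'I.
  apply: yinj => //; rewrite qr qr'; congr Some; apply: inj.
  - by case: qI => p pq; exists p; rewrite /= act_cat /mul /= /pmap_mul [act w0 p]pq.
  - by case: q'I => p pq; exists p; rewrite /= act_cat /mul /= /pmap_mul [act w0 p]pq.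
  - by rewrite (base_act qr) (base_act qr') qq'.
have [z zb] := trans_onto b.
have fI q : pmap_image (val f) q -> exists2 p, pmap_image (act w0) p & act z p = Some q.
  rewrite fE -zb => -[p]; rewrite !val_transM.
  case: (val a p) => //= p1; case E: (act w0 p1) => [p2|] //= p2q.
  by exists p2 => //; exists p1.
move=> q r /fI [q' q'I q'q] /fI [r' r'I r'r].
have [[u qu] [v rv]] := (base_range q', base_range r').
rewrite (base_act q'q) (base_act r'r) qu rv -!residual_cat => /(rho_cancel hZ) uv.
move: q'q; rewrite (inj0 q' r') ?qu ?rv ?uv // r'r => -[] //.
Qed.

(* Some power of a word returning from [w] to [w] through [v] fixes the image of
   [w] pointwise. *)
Lemma minimal_rank_return w v : F w -> F v -> minimal_rank F (phiX X w) ->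
  Defs.factor (phiX X v) (phiX X w).
Proof.
move=> Fw Fv wmin; have [y Fwyv] := ur_recurrent hF Fw Fv.
have [z] := ur_recurrent hF Fwyv Fw; rewrite -!catA.
set s := y ++ v ++ z ++ w => Fws.
have [sdef sinj] := minimal_rank_act Fws wmin.
pose I0 := pmap_image (act (L := star X) w); pose t := phiX X s.
have tI q : I0 q -> exists2 r, I0 r & val t q = Some r.
  move=> /sdef [r qr]; exists r => //.
  have : pmap_image (val t) r by exists q.
  by rewrite /t /s !catA /phiX trans_morphism.2 => /image_transM.
have tkI k q : I0 q -> exists2 r, I0 r & val (t ^+ k) q = Some r.
  elim: k => [|k IH] Iq; first by exists q => //=; rewrite act_nil.
  have [r Ir qr] := IH Iq; have [r' Ir' rr'] := tI _ Ir.
  by exists r' => //; rewrite expgSr val_transM qr.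
have tkinj k q q' : I0 q -> I0 q' -> val (t ^+ k) q = val (t ^+ k) q' -> q = q'.
  elim: k q q' => [|k IH] q q' Iq Iq'; first by rewrite /= act_nil => -[].
  rewrite !expgS !val_transM; have [r Ir qr] := tI _ Iq; have [r' Ir' qr'] := tI _ Iq'.
  rewrite qr qr' /= => /(IH _ _ Ir Ir') rr'; apply: sinj => //.
  by rewrite -[act s q]/(val t q) -[act s q']/(val t q') qr qr' rr'.
have [i [j [j0 tij]]] := finite_pigeonhole (fun k => t ^+ k) X_transition_finite.
(* Injectivity of [t ^+ i] on [I0] cancels it from [t ^+ i = t ^+ (i + j)]. *)
have tj q : I0 q -> val (t ^+ j) q = Some q.
  move=> Iq; have [r Ir qr] := tkI j _ Iq; rewrite qr; congr Some.
  by apply: (tkinj i) => //; rewrite [in RHS]tij addnC expgnDr val_transM qr.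
have wE : phiX X w = phiX X w * t ^+ j.
  apply/val_inj/funext => p; rewrite val_transM.
  case E: (val _ p) => [q|] //=; rewrite tj //; by exists p.
exists (phiX X w * phiX X y), (phiX X z * phiX X w * t ^+ j.-1).
case: j j0 wE {tij tj} => // j _ {1}->; rewrite expgS /t /s /phiX !trans_morphism.2.
by rewrite !mulgA.
Qed.

Lemma JX_Jrel2 f m : JX F X f -> JX F X m -> Jrel f m.
Proof.
move=> [_ [[w Fw <-] wmin] fw] [_ [[v Fv <-] vmin] mv].
apply: Jrel_trans fw _; apply: Jrel_trans (Jrel_sym mv).
by split; apply: minimal_rank_return => //; split=> //; eexists; eauto.
Qed.

Lemma act_F_def w : F w -> exists p q, act w p = Some q :> option (states (star X)).
Proof.
move=> /(star_X_completion hF hZ) [t wt].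
have st : sigma [::] \in states (star X).
  by apply/mem_set; split; [exists [::]; exact: star_nil|exists [::]].
exists (exist (fun S => S \in states (star X)) _ st); apply: act_def.
by exists t.
Qed.

Lemma JX_image_nonempty f : JX F X f -> exists q, pmap_image (val f) q.
Proof.
case=> _ [[w Fw <-] _] [[a [b wE]] _].
have [p [q pq]] := act_F_def Fw; move: pq; rewrite -[act w]/(val (phiX X w)) wE.
rewrite !val_transM; case: (val a p) => //= p1.
by case E: (val f p1) => [p2|] // _; exists p2, p1.
Qed.

Lemma JX_Jrel f m : JX F X f -> Jrel f m -> JX F X m.
Proof.
by case=> w wmin fw fm; exists w => //; apply: Jrel_trans fw; exact: Jrel_sym.
Qed.

(** Since [m * m' = f] fixes the image of [f] pointwise, [m] is defined there, and [m * f = m] keeps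
    it in that image. *)
Lemma Hrel_act f m p : f * f = f -> Hrel f m -> pmap_image (val f) p ->
  exists2 q, pmap_image (val f) q & val m p = Some q.
Proof.
move=> ff /(Hrel_idemP _ ff) [_ mf [m' _ [mm' _]]] [p0 p0p].
have : val (m * m') p = Some p.
  by rewrite mm'; move: (p0p); rewrite -{1}ff val_transM p0p.
rewrite val_transM; case E: (val m p) => [q|//] _; exists q => //.
by apply: (@image_transM _ _ m f); rewrite mf; exists p.
Qed.

(** The relational morphism given by common words. On a group H-class, separation lets [g] determine
    [m], and fullness lets [m] determine [g]. *)
Definition linked m (g : synt_monoid (star Z)) := exists2 z, phiX X z = m & h z = g.

Lemma linkedM m m' g g' : linked m g -> linked m' g' -> linked (m * m') (g * g').
Proof.
move=> [z <- <-] [z' <- <-]; exists (z ++ z'); first exact: trans_morphism.2.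
by rewrite (synt_proj_morphism (star Z)).2.
Qed.

(** Words with the same class in [G] send a state to states with equal bases; these lie in the image
    of [f], where the base separates. *)
Lemma linked_inj f m m' g : base_separated f -> f * f = f -> Hrel f m -> Hrel f m' ->
  linked m g -> linked m' g -> m = m'.
Proof.
move=> sep ff fm fm' [z zm <-] [z' zm' zz'].
have [[fme _ _] [fme' _ _]] := ((Hrel_idemP _ ff).1 fm, (Hrel_idemP _ ff).1 fm').
apply/val_inj/funext => p0; rewrite -fme -fme' !val_transM.
case p0p: (val f p0) => [p|] //=.
have fp : pmap_image (val f) p by exists p0.
have [q fq pq] := Hrel_act ff fm fp; have [r fr pr] := Hrel_act ff fm' fp.
rewrite pq pr; congr Some; apply: sep => //.
rewrite -zm in pq; rewrite -zm' in pr.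
rewrite (base_act pq) (base_act pr); have [u ->] := base_range p.
by rewrite -!residual_cat; apply/((synt_proj_residual _ _ _).1 _ u)/esym.
Qed.

(** With [base_separated], this makes [base] a bijection from the image of [f] onto the [d] states
    of the group automaton. *)
Definition full f : Prop := forall u, exists2 p, pmap_image (val f) p & base p = rho u.

Lemma linked_fun f m g g' : full f -> f * f = f -> Hrel f m ->
  linked m g -> linked m g' -> g = g'.
Proof.
move=> ful ff fm [z zm <-] [z' zm' <-]; apply/synt_proj_residual => u.
have [p fp pu] := ful u; have [q _ pq] := Hrel_act ff fm fp.
have := pq; rewrite -{1}zm => /base_act; rewrite pu -residual_cat => <-.
by move: pq; rewrite -zm' => /base_act; rewrite pu -residual_cat.
Qed.

(** If the right remainders of two parses have the same residual, they differ by a factor [e] of [w]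
    in [star Z], hence in [star X]; a nonempty [e] would make a remainder begin with a code word.
    The left remainders are compared in the same way with suffixes. *)
Lemma parses_rho_inj w : F w ->
  {in parses X w &, injective (fun c => rho c.2)}.
Proof.
move=> Fw [[p x] q] [[p' x'] q'] /set_mem [wE pX xX qX] /set_mem [wE' pX' xX' qX'] /= qq'.
have XZ v : star X v -> star Z v by apply: star_sub => ? [].
have q_eq (p1 x1 q1 q2 e : seq A) : w = p1 ++ x1 ++ q1 ->
    (forall y, X y -> ~~ prefix y q1) -> rho q1 = rho q2 -> q1 = e ++ q2 -> e = [::].
  move=> E q1X rq q1E; apply: contrapT => e0.
  have eZ : star Z e by apply/(rho_nilP hZ)/(rho_cancel hZ (y := q2)); rewrite -q1E.
  have Fe : F e.
    by apply: (ur_factor hF (x := p1 ++ x1) (y := q2)); rewrite -catA -q1E -E.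
  have [y [v [ev Xy _]]] := star_inv X_nil (star_factor_F hF eZ Fe) e0.
  by have := q1X _ Xy; rewrite q1E ev -catA prefix_prefix.
have {qq'} qE : q = q'.
  have : (p ++ x) ++ q = (p' ++ x') ++ q' by rewrite -!catA -wE -wE'.
  move=> /cat_levi [[e [_ E]]|[e [_ E]]].
    by rewrite E (q_eq _ _ _ _ _ wE qX qq' E).
  by rewrite E (q_eq _ _ _ _ _ wE' qX' (esym qq') E).
have p_eq (p1 x1 p2 x2 e : seq A) : F (p1 ++ x1) -> star X x1 -> star X x2 ->
    (forall y, X y -> ~~ suffix y p1) -> p1 = p2 ++ e -> x2 = e ++ x1 -> e = [::].
  move=> Fp x1X x2X p1X p1E x2E; apply: contrapT => e0.
  have eZ : star Z e.
    apply/(rho_nilP hZ)/(rho_cancel hZ (y := x1)); rewrite -x2E.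
    by rewrite !(rho_nilP hZ _).2 //; exact: XZ.
  have Fe : F e by apply: (ur_factor hF (x := p2) (y := x1)); rewrite catA -p1E.
  have eX := star_factor_F hF eZ Fe.
  have [v [y [eE Xy]]] := star_inv_suffix eX e0.
  by have := p1X _ Xy; rewrite p1E eE catA suffix_suffix.
have FE (p1 x1 : seq A) : w = p1 ++ x1 ++ q -> F (p1 ++ x1).
  by move=> E; apply: (ur_prefix hF (y := q)); rewrite -catA -E.
move: wE' xX' pX' qX'; rewrite -qE => wE' xX' pX' qX'.
have : p ++ x = p' ++ x'.
  have : (p ++ x) ++ q = (p' ++ x') ++ q by rewrite -!catA -wE -wE'.
  move=> E; apply/eqP; move/eqP: (E); rewrite eqseq_cat; first by case/andP.
  by move/(congr1 size): E; rewrite !(size_cat _ q) => /addIn.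
move=> /cat_levi [[e [p'E xE]]|[e [pE x'E]]].
  have e0 := p_eq p' x' p x e (FE _ _ wE') xX' xX pX' p'E xE.
  by rewrite p'E xE e0 cats0.
have e0 := p_eq p x p' x' e (FE _ _ wE) xX xX' pX pE x'E.
by rewrite pE x'E e0 cats0.
Qed.

Lemma parses_card_le w : F w -> parses X w #<= `I_d.
Proof.
move=> Fw; rewrite -(card_le_eql (inj_card_eq (parses_rho_inj Fw))).
rewrite -(card_le_eqr (rho_card hZ)); apply: subset_card_le.
by move=> _ [[[p x] q] _ <-]; exists q.
Qed.

(** The hypothesis says that [w], read from any state of the group automaton, passes through the
    initial state. Cutting [w] there yields a parse for each end state. *)
Lemma parses_card_eq w : F w ->
  (forall u, exists w1 w2, w = w1 ++ w2 /\ rho (u ++ w1) = rho [::]) ->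
  parses X w #= `I_d.
Proof.
move=> Fw wP; apply: card_eq_trans (rho_card hZ).
apply: (card_eq_trans (card_esym (inj_card_eq (parses_rho_inj Fw)))).
suff -> : (fun c : seq A * seq A * seq A => rho c.2) @` parses X w = range rho by [].
apply/seteqP; split=> [_ [[[p x] q] _ <-]|_ [v _ <-]]; first by exists q.
have [w' [_ w'w]] := synt_inverse hZ w.
(* Starting from [v ++ w'], with [w'] inverse to [w], the reading of [w] ends in the state of
   [v]. *)
have [w1 [w2 [wE vw1]]] := wP (v ++ w').
have vw2 : rho v = rho w2.
  have /(_ v) := (synt_proj_residual _ _ _).1 w'w.
  by rewrite cats0 => <-; rewrite wE !catA residual_cat vw1 -residual_cat.
have [p [x [w1E xX pX]]] := star_factor_suffix w1 X_nil.
have [x' [q [w2E x'X qX]]] := star_factor_prefix w2 X_nil.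
exists (p, x ++ x', q).
  by split=> //; [rewrite wE w1E w2E !catA | exact: star_cat].
rewrite /= vw2 w2E -[q in LHS]cat0s; apply: rho_cat.
by apply/esym/(rho_nilP hZ); apply: star_sub x'X => ? [].
Qed.

Lemma full_factor f f' a b : full f -> f = a * f' * b -> full f'.
Proof.
have [z <-] := trans_onto b; move=> ful fE u.
have [p [p0]] := ful (u ++ z); rewrite fE !val_transM.
case: (val a p0) => //= p1; case E: (val f' p1) => [p2|] //= p2p pu.
exists p2; first by exists p1.
have [v p2v] := base_range p2; rewrite p2v.
apply: (rho_cancel hZ (y := z)); rewrite -pu (base_act p2p) p2v.
by rewrite residual_cat.
Qed.
End Code.

(** * Pseudowords *)

Section Pseudowords.
Context {A : finType}.
Implicit Types (u v : pword A) (w x y : seq A) (M N : gen_monoid A).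

Definition gm_eval M w : 'I_(gm_card M) := val (pword_of w) M.

(** Equivalently, [M] is a quotient of [N] as a generated monoid; the formulation on words avoids
    carrying morphisms. *)
Definition gm_dom N M : Prop :=
  forall w x, gm_eval N w = gm_eval N x -> gm_eval M w = gm_eval M x.

Lemma gm_eval_cat M w x : gm_eval M (w ++ x) = gm_mul (gm_eval M w) (gm_eval M x).
Proof.
rewrite /gm_eval /=; elim: w => [|a w IH] /=; first by rewrite gm_mul1.
by rewrite IH gm_mulA.
Qed.

Lemma gm_eval_onto M (i : 'I_(gm_card M)) : exists w, gm_eval M w = i.
Proof. exact: gm_generated. Qed.

Lemma gm_dom_pword N M u w : gm_dom N M ->
  val u N = gm_eval N w -> val u M = gm_eval M w.
Proof.
move=> NM uw.
pose f (i : 'I_(gm_card N)) := gm_eval M (projT1 (cid (gm_eval_onto i))).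
have fE x : f (gm_eval N x) = gm_eval M x.
  by rewrite /f; case: cid => y /= /NM.
have fm : gm_morphism f.
  split=> [|i j|a]; first by rewrite -[gm_one N]/(gm_eval N [::]) fE.
    have [[y <-] [z <-]] := (gm_eval_onto i, gm_eval_onto j).
    by rewrite -gm_eval_cat !fE gm_eval_cat.
  have gE K : gm_gen K a = gm_eval K [:: a] by rewrite /gm_eval /= gm_mulr1.
  by rewrite !gE fE.
by rewrite -(set_mem (valP u) _ _ _ fm) uw fE.
Qed.

Lemma pword_ext u v : (forall M, val u M = val v M) -> u = v.
Proof. by move=> uv; apply/val_inj/functional_extensionality_dep. Qed.

Lemma gm_of_morphism (K : monoidType) (phi : seq A -> K) :
  finite_set (range phi) -> monoid_morphism phi ->
  exists N, forall w x, gm_eval N w = gm_eval N x -> phi w = phi x.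
Proof.
move=> fK pm; have [t tE] := (finite_seqP _).1 fK.
have sE k : reflect (exists w, phi w = k) (k \in undup t).
  rewrite mem_undup; apply: (iffP idP) => [kt|[w <-]].
    have : [set` t] k by [].
    by rewrite -tE => -[w _ <-]; exists w.
  by have : range phi (phi w) by [exists w]; rewrite tE.
have [_ _] := @continuous_extension_exists A K phi pm _ sE (undup_uniq t).
set N := GenMonoid _ _ _ _ => phiE; exists N => w x wx; rewrite -!phiE.
exact: (congr1 (fun i : 'I_(gm_card N) => nth 1 (undup t) i) wx).
Qed.

(** [K] is the submonoid generated in the product, realized by right multiplication on pairs. *)
Lemma gm_join M N : exists K, gm_dom K M /\ gm_dom K N.
Proof.
pose T : finType := ('I_(gm_card M) * 'I_(gm_card N))%type.
pose phi w : partial_map T :=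
  fun t => Some (gm_mul t.1 (gm_eval M w), gm_mul t.2 (gm_eval N w)).
have pm : monoid_morphism phi.
  split=> [|w x]; apply/funext => -[i j]; first by rewrite /phi /= !gm_mulr1.
  by rewrite /phi /mul /= /pmap_mul /= !gm_eval_cat !gm_mulA.
have [|K KP] := gm_of_morphism (phi := phi) _ pm.
  apply: (sub_finite_set (B := setT)) => //.
  exact/finite_partial_maps/finite_finset.
exists K; split=> w x /KP /(congr1 (@^~ (gm_one M, gm_one N))) [];
  by rewrite !gm_mul1.
Qed.

(** Words act on the words of length at most [n] by concatenation, undefined beyond that length; the
    action on the empty word recovers [w]. *)
Lemma gm_length n : exists K, forall w x, (size w <= n)%N ->
  gm_eval K w = gm_eval K x -> w = x.
Proof.
pose T : finType := n.-bseq A.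
pose phi w : partial_map T := fun t => insub (val t ++ w).
have pm : monoid_morphism phi.
  split=> [|w x]; apply/funext => t; first by rewrite /phi cats0 valK.
  rewrite /phi /mul /= /pmap_mul /= catA.
  case: (insubP T (val t ++ w)) => [s _ <- //|] /= nw.
  rewrite insubF //; apply/negbTE; move: nw; apply: contra.
  by apply: leq_trans; rewrite (size_cat _ x) leq_addr.
have [|K KP] := gm_of_morphism (phi := phi) _ pm.
  apply: (sub_finite_set (B := setT)) => //.
  exact/finite_partial_maps/finite_finset.
exists K => w x wn /KP /(congr1 (@^~ [bseq])); rewrite /phi /= => E.
move: E; rewrite insubT => E; move: E.
by case: insubP => // s _ <- [<-].
Qed.

Lemma nbhs_gm u M : nbhs u [set v | val v M = val u M].
Proof.
have : continuous (fun u : pword A => val u M : gm_carrier M).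
  move=> v.
  apply: (@continuous_comp (pword A) (prod_topology (@gm_carrier A))
    (gm_carrier M) val (fun f => f M) v).
    exact: (@initial_continuous (pword A) (prod_topology (@gm_carrier A)) val).
  exact: (@proj_continuous _ (fun M => (gm_carrier M : topologicalType)) M).
move=> /(_ u [set val u M]); apply; exact: discrete_set1.
Qed.

(** A single level suffices because [gm_join] makes the levels directed. *)
Lemma nbhs_gmP u U : nbhs u U -> exists M, forall v, val v M = val u M -> U v.
Proof.
pose B : set_system (pword A) :=
  [set V | exists M, forall v, val v M = val u M -> V v].
have fB : Filter B.
  split=> [||V W VW [M MV]].
  - have [K _] := gm_length 0; by exists K.
  - move=> V W [M MV] [N NW]; have [K [KM KN]] := gm_join M N.
    exists K => v vu; have [w wu] := gm_eval_onto (val u K).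
    by split; [apply: MV|apply: NW];
      rewrite (gm_dom_pword (N := K) (w := w)) 1?(gm_dom_pword (N := K) (u := u) (w := w)) ?vu.
  - by exists M => v /MV /VW.
rewrite nbhsE => -[V [[C Cop <-] Cu] VU].
have cvg : (val @ B : set_system (prod_topology (@gm_carrier A))) --> val u.
  apply/cvg_sup => M D; rewrite nbhsE => -[E [[G _ <-] Gu] ED].
  by exists M => v vu; apply: ED; rewrite /= /proj /= in Gu *; rewrite vu.
have [M MP] := cvg _ (open_nbhs_nbhs (conj Cop Cu)).
by exists M => v /MP /VU.
Qed.

Lemma hat_eval (K : monoidType) (phi : seq A -> K) :
  finite_set (range phi) -> monoid_morphism phi ->
  exists N, forall u w, val u N = gm_eval N w -> hat phi u = phi w.
Proof.
move=> fK pm; have [N NP] := gm_of_morphism fK pm; exists N => u w uw.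
have [_ ct pE] := hatP fK pm.
have : nbhs u [set v | hat phi v = hat phi u].
  have := ct u [set hat phi u]; apply; exact: discrete_set1.
move=> /nbhs_gmP [M MP]; have [J [JM JN]] := gm_join M N.
have [x xu] := gm_eval_onto (val u J).
have xM := gm_dom_pword JM (esym xu); have xN := gm_dom_pword JN (esym xu).
by rewrite -(MP (pword_of x)) ?pE //; apply: NP; rewrite -xN.
Qed.

Lemma closure_eval (F : set (seq A)) v M : closure (@pword_of A @` F) v ->
  exists2 w, F w & gm_eval M w = val v M.
Proof.
by move=> /(_ _ (nbhs_gm v M)) [_ [[w Fw <-] vM]]; exists w.
Qed.

(** Otherwise a level that also recognizes words of length at most [n] sees [v] as one short word
    [w]. Every finer level then agrees, so [v] would be [w]. *)
Lemma infinite_eval (F : set (seq A)) v M n :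
  closure (@pword_of A @` F) v -> infinite_pword v ->
  exists w, [/\ F w, (n <= size w)%N & gm_eval M w = val v M].
Proof.
move=> cl inf; apply: contrapT => nex.
have [K KP] := gm_length n; have [J [JM JK]] := gm_join M K.
have [w Fw wJ] := closure_eval J cl.
have wM := gm_dom_pword JM (esym wJ); have wK := gm_dom_pword JK (esym wJ).
have wn : (size w <= n)%N.
  rewrite leqNgt; apply/negP => nw; apply: nex; exists w; rewrite wM.
  by split=> //; exact: ltnW.
apply: inf; exists w => //; apply: pword_ext => P.
have [R [RP RK]] := gm_join P K; have [x _ xR] := closure_eval R cl.
rewrite (gm_dom_pword RP (esym xR)).
have : gm_eval K w = gm_eval K x by rewrite -(gm_dom_pword RK (esym xR)) wK.
by move=> /(KP _ _ wn) <-.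
Qed.

(* Compactness: the factorizations found at each finite level converge along an
   ultrafilter on the set of levels, ordered by domination. *)
Lemma pword_factor_limit u v :
  (forall M, exists w x, val u M = gm_mul (gm_mul (gm_eval M w) (val v M)) (gm_eval M x)) ->
  exists a b, u = a * v * b.
Proof.
move=> uv.
pose s M := projT1 (cid (uv M)).
pose t M := projT1 (cid (projT2 (cid (uv M)))).
have stP M : val u M = gm_mul (gm_mul (gm_eval M (s M)) (val v M)) (gm_eval M (t M)).
  exact: (projT2 (cid (projT2 (cid (uv M))))).
pose up := filter_from [set: gen_monoid A] (fun N => [set M | gm_dom M N]).
have pup : ProperFilter up.
  apply: filter_from_proper; last by move=> N _; exists N.
  apply: filter_from_filter; first by have [K _] := gm_length 0; exists K.
  move=> M N _ _; have [K [KM KN]] := gm_join M N; exists K => // P PK.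
  by split=> w x /PK; [move=> /KM|move=> /KN].
have [U [uU upU]] := ultraFilterLemma pup.
(* At each finite level the ultrafilter selects one value of the chosen words; these values form a
   compatible family. *)
have lim (c : gen_monoid A -> seq A) : exists a : pword A,
    forall N, U [set M | gm_eval N (c M) = val a N].
  have ex N : exists i, U [set M | gm_eval N (c M) = i].
    apply: contrapT => nex.
    have : U (\bigcap_(i in [set: 'I_(gm_card N)]) ~` [set M | gm_eval N (c M) = i]).
      apply: filter_forall => i.
      have [h|h] := in_ultra_setVsetC [set M | gm_eval N (c M) = i] uU.
        by case: nex; exists i.
      by apply: filterS h => M hM _.
    by move=> /filter_ex [M] /(_ (gm_eval N (c M)) I) /=.
  pose a N := projT1 (cid (ex N)).
  have aP N : U [set M | gm_eval N (c M) = a N] by rewrite /a; case: cid.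
  have ac : (a : prod_topology (@gm_carrier A)) \in @compatible A.
    apply/mem_set => M N f fm.
    have [P [/= <- <-]] := filter_ex (@filterI _ U _ _ _ (aP M) (aP N)).
    exact: (set_mem (valP (pword_of (c P)))).
  by exists (exist (fun a => a \in @compatible A) _ ac).
have [a aP] := lim s; have [b bP] := lim t.
exists a, b; apply: pword_ext => N.
have UN : U [set M | gm_dom M N] by apply: upU; exists N.
have [M [MN [aM bM]]] := filter_ex (@filterI _ U _ _ _ UN (@filterI _ U _ _ _ (aP N) (bP N))).
have [y yv] := gm_eval_onto (val v M).
transitivity (gm_mul (gm_mul (val a N) (val v N)) (val b N)); last by [].
rewrite -[val a N]aM -[val b N]bM (gm_dom_pword MN (esym yv)) -!gm_eval_cat.
apply: (gm_dom_pword MN).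
by rewrite stP -yv !gm_eval_cat.
Qed.

(** At each level [v] is seen as a word of [F], and [u] as a word of [F] long enough to contain
    it. *)
Lemma infinite_Jrel (F : set (seq A)) u v : uniformly_recurrent F ->
  closure (@pword_of A @` F) u -> infinite_pword u ->
  closure (@pword_of A @` F) v -> infinite_pword v -> Jrel u v.
Proof.
move=> hF; move: u v.
suff fac u v : closure (@pword_of A @` F) u -> infinite_pword u ->
    closure (@pword_of A @` F) v -> Defs.factor v u.
  by move=> u v cu iu cv iv; split; apply: fac.
move=> cu iu cv; apply: pword_factor_limit => M.
have [x Fx <-] := closure_eval M cv; have [n nP] := ur_long hF Fx.
have [w [Fw nw <-]] := infinite_eval M n cu iu.
by have [p [q ->]] := nP _ Fw nw; exists p, q; rewrite !gm_eval_cat gm_mulA.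
Qed.
End Pseudowords.

(** An alias depending on [M], to carry its monoid structure. *)
Definition gm_type (A : finType) (M : gen_monoid A) : Type := 'I_(gm_card M).
HB.instance Definition _ (A : finType) (M : gen_monoid A) := Choice.on (gm_type M).
HB.instance Definition _ (A : finType) (M : gen_monoid A) :=
  isMonoid.Build (gm_type M) (@gm_mulA A M) (@gm_mul1 A M) (@gm_mulr1 A M).

Lemma pword_idem_stable (A : finType) : idem_stable (M := pword A).
Proof.
move=> e x a b ee xx ex xe eE; apply: pword_ext => M.
pose ev (u : pword A) : gm_type M := val u M.
have evM u v : ev (u * v) = ev u * ev v by [].
apply: (@finite_idem_stable (gm_type M) _ (ev e) (ev x) (ev a) (ev b));
  rewrite -?evM ?ee ?xx ?ex ?xe -?eE //.
exact: finite_finset.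
Qed.

(** * Maximal subgroups *)

Section Main.
Context {A : finType} {F Z : set (seq A)} {d : nat}.
Context (hF : uniformly_recurrent F) (hZ : group_code Z d).
Local Notation X := (Z `&` F).
Local Notation rho := (residual (star Z)).
Local Notation h := (synt_proj (star Z)).
Local Notation G := (synt_monoid (star Z)).
Local Notation M := (transition_monoid (star X)).
Local Notation hh := (hat (h : seq A -> G)).
Local Notation hphi := (hat (phiX X)).
Implicit Types (u v e : pword A) (f m : M) (g : G).

Let range_h : finite_set (range (h : seq A -> G)).
Proof. exact: sub_finite_set (synt_finite hZ). Qed.

Let range_phi : finite_set (range (phiX X)).
Proof. exact: sub_finite_set (X_transition_finite hF hZ). Qed.

Lemma hat_h_morphism : monoid_morphism hh.
Proof. by have [] := hatP range_h (synt_proj_morphism _). Qed.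

Lemma hat_phi_morphism : monoid_morphism hphi.
Proof. by have [] := hatP range_phi trans_morphism. Qed.

Lemma hat_level : exists N, forall u w, val u N = gm_eval N w ->
  hh u = h w /\ hphi u = phiX X w.
Proof.
have [N NP] := hat_eval range_h (synt_proj_morphism _).
have [K KP] := hat_eval range_phi trans_morphism.
have [J [JN JK]] := gm_join N K; exists J => u w uw.
by split; [apply: NP; exact: gm_dom_pword uw|apply: KP; exact: gm_dom_pword uw].
Qed.

Lemma linked_hat u : linked (hphi u) (hh u).
Proof.
have [N NP] := hat_level; have [w wu] := gm_eval_onto (val u N).
by have [-> ->] := NP _ _ (esym wu); exists w.
Qed.

Lemma linked_total m : exists g, linked m g.
Proof. by have [w <-] := trans_onto m; exists (h w), w. Qed.

Lemma synt_group_idem g : g * g = g -> g = 1.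
Proof.
have [w <-] := synt_proj_onto g; have [w' [ww' _]] := synt_inverse hZ w.
have hM := (synt_proj_morphism (star Z)).2; move=> ww.
have one : h w * h w' = 1 by rewrite -hM ww'.
by rewrite -[LHS]mulg1 -one mulgA ww.
Qed.

Lemma JF_Jrel u v : JF F u -> Jrel u v -> JF F v.
Proof.
move=> [t [ct it ut]] uv; exists t; split=> //.
by apply: Jrel_trans ut; exact: Jrel_sym.
Qed.

Lemma JF_Jrel2 u v : JF F u -> JF F v -> Jrel u v.
Proof.
move=> [s [cs is_ us]] [t [ct it vt]]; apply: Jrel_trans us _.
by apply: Jrel_trans (Jrel_sym vt); exact: infinite_Jrel hF cs is_ ct it.
Qed.

Lemma infinite_hat_phi v n : closure (@pword_of A @` F) v -> infinite_pword v ->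
  exists w, [/\ F w, (n <= size w)%N & hphi v = phiX X w].
Proof.
move=> cv iv; have [N NP] := hat_level.
have [w [Fw nw /esym/NP [_ vw]]] := infinite_eval N n cv iv.
by exists w.
Qed.

(** An infinite pseudoword in the closure of [F] acts like a word of [F] long enough to contain a
    word of minimal rank. *)
Lemma JF_JX u : JF F u -> JX F X (hphi u).
Proof.
move=> [v [cv iv uv]]; have [w0 Fw0 w0min] := minimal_rank_exists hF hZ.
have [n nP] := ur_long hF Fw0; have [w [Fw nw vw]] := infinite_hat_phi n cv iv.
exists (phiX X w); last by rewrite -vw; exact: (morph_Jrel hat_phi_morphism uv).
by have [p [q wE]] := nP _ Fw nw; move: Fw; rewrite wE => Fw; exact: minimal_rank_factor.
Qed.

Lemma hat_phi_inj e u v : JF F e -> e * e = e -> Hrel e u -> Hrel e v ->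
  hh u = hh v -> hphi u = hphi v.
Proof.
move=> Je ee eu ev uv; apply: (linked_inj hZ (f := hphi e) (g := hh u)).
- exact (base_separated_JX hF hZ (JF_JX Je)).
- by rewrite -hat_phi_morphism.2 ee.
- exact: (morph_Hrel hat_phi_morphism eu).
- exact: (morph_Hrel hat_phi_morphism ev).
- exact: linked_hat.
- by rewrite uv; exact: linked_hat.
Qed.

(** * Consequences of surjectivity onto [G] *)

Definition onto_G e := forall g, exists2 u, Hrel e u & hh u = g.

Lemma onto_G_conj e e' : JF F e -> e * e = e -> JF F e' -> e' * e' = e' ->
  onto_G e -> onto_G e'.
Proof.
move=> Je ee Je' ee' oe g.
have [c [b [cb bc [fc _] [_ bf]]]] := idem_conj (@pword_idem_stable A) ee ee' (JF_Jrel2 Je Je').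
have [u eu ug] := oe (hh b * g * hh c); exists (c * u * b).
  exact: Hrel_conj bc fc bf eu.
have hM := hat_h_morphism.2.
have one : hh c * hh b = 1 by rewrite -hM cb; apply: synt_group_idem; rewrite -hM ee'.
by rewrite !hM ug !mulgA one mul1g -mulgA one mulg1.
Qed.

(** From one state of the image, with base [rho y], an element of the group over the inverse of [y]
    times [x] leads to base [rho x] within the image. *)
Lemma onto_G_full e : JF F e -> e * e = e -> onto_G e -> full (hphi e).
Proof.
move=> Je ee oe x; have ff : hphi e * hphi e = hphi e by rewrite -hat_phi_morphism.2 ee.
have [p fp] := JX_image_nonempty hF hZ (JF_JX Je).
have [y py] := base_range p; have [y' [yy' _]] := synt_inverse hZ y.
have [u eu uh] := oe (h (y' ++ x)).
have [q fq pq] := Hrel_act ff (morph_Hrel hat_phi_morphism eu) fp.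
exists q => //; have [z zphi zh] := linked_hat u.
move: pq; rewrite -zphi => /(base_act hZ) ->; rewrite py -residual_cat.
move: zh; rewrite uh => /synt_proj_residual ->; rewrite catA.
have /(_ [::]) /= := (synt_proj_residual _ _ _).1 yy'.
exact: rho_cat.
Qed.

(** The idempotent factors through a long word [w] of [F]. Fullness gives paths through [w] from
    every state of the group automaton, and each meets the initial state. *)
Lemma onto_G_degree e : JF F e -> e * e = e -> onto_G e -> has_degree F X d.
Proof.
move=> Je ee oe; split; last by move=> w; exact: parses_card_le.
have ff : hphi e * hphi e = hphi e by rewrite -hat_phi_morphism.2 ee.
have ful := onto_G_full Je ee oe.
case: (Je) => v [cv iv [_ [a [b eE]]]].
have [N NX] := X_bounded hF hZ; have [w [Fw Nw vw]] := infinite_hat_phi N cv iv.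
exists w => //; apply: (parses_card_eq hF hZ) => // x.
have [z zphi] := trans_onto (hphi a); have [z' [_ z'z]] := synt_inverse hZ z.
(* As [z'] is inverse to [z], reading [z] from [p] leads to base [rho x] just before [w]. *)
have [p fp px] := ful (x ++ z').
have eeH : Hrel (hphi e) (hphi e) by split; split; exists (hphi e).
have [q _] := Hrel_act ff eeH fp.
rewrite {1}eE !hat_phi_morphism.2 vw -zphi !val_transM.
case E : (val (trans (star X) z) p) => [p1|] //=.
case E' : (act w p1) => [p2|] // _.
have [w1 [w2 [wE _ p1w]]] := act_cut hZ NX Nw E'.
have p1x : base p1 = rho x.
  rewrite (base_act hZ E) px -residual_cat -catA.
  by have /(_ x) := (synt_proj_residual _ _ _).1 z'z; rewrite cats0.
by exists w1, w2; split=> //; rewrite residual_cat -p1w p1x.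
Qed.

Lemma onto_G_image e : JF F e -> e * e = e -> onto_G e ->
  hphi @` [set u | Hrel e u] = [set m | Hrel (hphi e) m].
Proof.
move=> Je ee oe; apply/seteqP; split=> [_ [u eu <-]|m /= fm].
  exact: (morph_Hrel hat_phi_morphism eu).
have [g mg] := linked_total m; have [u eu ug] := oe g; exists u => //.
apply: (linked_inj hZ (f := hphi e) (g := g)) => //.
- exact (base_separated_JX hF hZ (JF_JX Je)).
- by rewrite -hat_phi_morphism.2 ee.
- exact: (morph_Hrel hat_phi_morphism eu).
- by rewrite -ug; exact: linked_hat.
Qed.

Lemma onto_G_structure_group e : JF F e -> e * e = e -> onto_G e ->
  structure_group_isomorphic (JX F X) G.
Proof.
move=> Je ee oe; set f0 := hphi e.
have ff0 : f0 * f0 = f0 by rewrite -hat_phi_morphism.2 ee.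
split; first by exists [set m | Hrel f0 m]; apply: maximal_subgroup_idem => //; exact: JF_JX.
move=> H1 /maximal_subgroupE [|f [Jf ff ->]]; first exact: JX_Jrel.
have JJ : Jrel f0 f := JX_Jrel2 hF hZ (JF_JX Je) Jf.
have ful : full f.
  by case: JJ => _ [a [b]]; apply: (full_factor hZ); exact: onto_G_full.
(* The isomorphism is [linked] itself, made a function by fullness; the default [1] is never taken,
   by [linked_total]. *)
pose k m := xget 1 [set g | linked m g].
have kE m g : Hrel f m -> linked m g -> k m = g.
  move=> fm mg; rewrite /k; case: xgetP => [g' _ mg'|/(_ g)] //.
  exact (linked_fun hZ ful ff fm mg' mg).
have kP m : Hrel f m -> linked m (k m).
  by move=> fm; have [g mg] := linked_total m; rewrite (kE _ g).
exists k; last first.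
  move=> x y fx fy; apply: kE; first by have [fM _] := Hclass_group ff; exact: fM.
  by apply: linkedM; exact: kP.
split=> //.
  move=> x y /set_mem fx /set_mem fy kxy.
  apply: (linked_inj hZ (f := f) (g := k x)) => //.
  - exact: (base_separated_JX hF hZ Jf).
  - exact: kP.
  - by rewrite kxy; exact: kP.
move=> g _.
have [c [b [cb bc [fc _] [_ bf]]]] :=
  idem_conj (finite_idem_stable (X_transition_finite hF hZ)) ff0 ff JJ.
have [gc cgc] := linked_total c; have [gb bgb] := linked_total b.
(* Both this product and its square are linked to [f], hence equal, and [G] has only one
   idempotent. *)
have one : gc * gb = 1.
  apply: synt_group_idem; apply: (linked_fun hZ (m := f) ful ff).
  - by split; split; exists f.
  - by rewrite -ff -{1}cb -cb; do !apply: linkedM.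
  - by rewrite -cb; exact: linkedM.
have [u eu ug] := oe (gb * g * gc).
have fm : Hrel f (c * hphi u * b).
  by apply: Hrel_conj bc fc bf _ => //; exact: (morph_Hrel hat_phi_morphism eu).
exists (c * hphi u * b) => //; apply: kE => //.
have -> : g = gc * (gb * g * gc) * gb.
  by rewrite !mulgA one mul1g -mulgA one mulg1.
by do !apply: linkedM => //; rewrite -ug; exact: linked_hat.
Qed.
End Main.

Theorem theorem10p18 (A : finType) (F Z : set (seq A)) (d : nat)
    (hF : uniformly_recurrent F) (hZ : group_code Z d)
    (H : set (pword A)) (hH : maximal_subgroup_in (JF F) H) :
  let X := Z `&` F in
  let G : monoidType := synt_monoid (star Z) in
  let h : seq A -> G := synt_proj (star Z) in
  set_surj H [set: G] (hat h) <->
  [/\ maximal_bifix_code F X /\ has_degree F X d,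
      structure_group_isomorphic (JX F X) G &
      forall H' : set (pword A), maximal_subgroup_in (JF F) H' ->
        maximal_subgroup_in (JX F X) (hat (phiX X) @` H')].
Proof.
move=> X G h.
have [e [Je ee HE]] := maximal_subgroupE hH (@JF_Jrel _ _).
split=> [hs|[_ [_ iso] /(_ _ hH) /iso [k [_ kI kS] _]]].
  have oe : onto_G (Z := Z) e.
    by move=> g; have [u Hu <-] := hs g I; exists u => //; rewrite HE in Hu.
  split; first split; first exact (X_maximal hF hZ).
  - exact (onto_G_degree hF hZ Je ee oe).
  - exact (onto_G_structure_group hF hZ Je ee oe).
  move=> H' /maximal_subgroupE [|e' [Je' ee' ->]]; first exact: JF_Jrel.
  rewrite (onto_G_image hF hZ Je' ee' (onto_G_conj hF hZ Je ee Je' ee' oe)).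
  apply: maximal_subgroup_idem; first exact (JF_JX hF hZ Je').
  by rewrite -(hat_phi_morphism hF hZ).2 ee'.
(* By (ii) and (iii), [k] after [hat phi_X] maps [H] onto [G]. A section [s] of it stays injective
   after [hat h], because [hat h] determines [hat phi_X] on [H]; finiteness of [G] then gives
   surjectivity. *)
have sP g : exists2 u, H u & k (hat (phiX X) u) = g.
  by have [_ [u Hu <-] <-] := kS g I; exists u.
pose s g := projT1 (cid2 (sP g)).
have sH g : H (s g) by rewrite /s; case: cid2.
have ks g : k (hat (phiX X) (s g)) = g by rewrite /s; case: cid2.
have inj : injective (fun g => hat h (s g)).
  move=> g g' /= E; rewrite -(ks g) -(ks g'); congr k.
  by apply: (hat_phi_inj hF hZ Je ee) => //; move: (sH g) (sH g'); rewrite HE.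
by move=> g _; have [g' <-] := finite_injective_onto (synt_finite hZ) inj g; exists (s g').
Qed.
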